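(* Let $A_1,\dots,A_N$ be real $2\times 2$ matrices with $A_j=P_jJ_jP_j^{-1}$, $P_j$ real invertible, where $A_1$ is Hurwitz stable and $A_2,\dots,A_N$ are unstable, with $P_1,\dots,P_N$ chosen so that each $P_j^{-1}P_1=\begin{pmatrix}a_j&b_j\\c_j&d_j\end{pmatrix}$, $j=2,\dots,N$, has determinant $1$ or $-1$. Let $J_1=\begin{pmatrix}-n_1&1\\0&-n_1\end{pmatrix}$ with $n_1>0$. Let $k,\ell\ge0$ be integers with $k+\ell+1\le N$ and assume: for $2\le j\le k+1$, $J_j=\begin{pmatrix}\alpha_j&\beta_j\\-\beta_j&\alpha_j\end{pmatrix}$ with $\alpha_j\ge0$, $\beta_j\ne0$; for $k+1<j\le k+\ell+1$, $J_j=\begin{pmatrix}n_j&1\\0&n_j\end{pmatrix}$ with $n_j\ge0$; for $k+\ell+1<j\le N$, $J_j=\mathrm{diag}(p_j,q_j)$ with $p_j\le q_j$, $(p_j,q_j)\ne(0,0)$. For $\epsilon\in\mathbb R$ and $\eta>0$ define: (a) for $2\le j\le k+1$, $\tau_{1,2}^{(j)}(\epsilon,\eta)$ is the unique positive solution $\tau$ of $$n_1\tau-\ln\theta(\tau)=\alpha_j\eta+\cosh^{-1}\left(\frac{a_j^2+(b_j+\epsilon a_j)^2+c_j^2+(d_j+\epsilon c_j)^2}{2}\right);$$ (b) for $k+1<j\le k+\ell+1$, $\tau_{1,2}^{(j)}(\epsilon,\eta)$ is the unique positive solution $\tau$ of $$n_1\tau-\ln\theta(\tau)=n_j\eta+\sinh^{-1}\left(\left(\frac{c_j^2+(d_j+\epsilon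 c_j)^2}{2}\right)\eta\right);$$ (c) for $k+\ell+1<j\le N$, $\tau_{1,2}^{(j)}(\epsilon,\eta)$ is the unique positive solution $\tau$ of $$n_1\tau-\ln\theta(\tau)=\left(\frac{p_j+q_j}{2}\right)\eta+\sinh^{-1}\left(\sqrt{K_j(\epsilon)}\,\sinh\left(\frac{q_j-p_j}{2}\,\eta\right)\right),$$ where $K_j(\epsilon)=(a_j^2+(b_j+\epsilon a_j)^2)(c_j^2+(d_j+\epsilon c_j)^2)$. Let $\tau(\eta)=\min_{\epsilon\in\mathbb R}\max\{\tau_{1,2}^{(2)}(\epsilon,\eta),\dots,\tau_{1,2}^{(N)}(\epsilon,\eta)\}$. Then the switched system $\dot x(t)=A_{\sigma(t)}x(t)$ is stable for all $\sigma\in\mathcal S_N[\tau(\eta),\eta]$ and asymptotically stable for all $\sigma\in\mathcal S_N'[\tau(\eta),\eta]$.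
   Context: $\theta(t)=\left\|\begin{pmatrix}1&t\\0&1\end{pmatrix}\right\|=\sqrt{1+\frac{t^2}{2}+t\sqrt{1+\frac{t^2}{4}}}$ (spectral norm). Hurwitz stable: all eigenvalues have negative real part; unstable: at least one eigenvalue has positive real part. The system is $\dot x(t)=A_{\sigma(t)}x(t)$, $x(t)\in\mathbb R^2$ continuous in $t\ge0$. A switching signal $\sigma:[0,\infty)\to\{1,\dots,N\}$ is right-continuous and piecewise constant with infinitely many discontinuities $0<d_1<d_2<\cdots$, $d_k\to\infty$, $d_0=0$; it is governed by the undirected star graph with internal node $A_1$ and leaves $A_2,\dots,A_N$, i.e. with $\sigma(0)=1$ one has $\sigma(d_{2k})=1$ for all $k\ge0$ and $\sigma(d_{2k-1})\in\{2,\dots,N\}$ for all $k\ge1$. Put $t_k=d_{2k-1}-d_{2k-2}$ (time spent in $A_1$) and $s_k=d_{2k}-d_{2k-1}$ (time spent in another subsystem), $k\ge1$. $\mathcal S_N[\tau,\eta]$ is the set of such signals with $\sigma(0)=1$, $t_k\ge\tau$, $s_k\le\eta$ for all $k\in\mathbb N$; $\mathcal S_N'[\tau,\eta]$ is the set of $\sigma\in\mathcal S_N[\tau,\eta]$ for which $(t_k,s_k)_{k\ge1}$ does not converge to $(\tau,\eta)$. For a given signal, the system is stable if for every $\varepsilon'>0$ there is $\delta>0$ such that $\|x(0)\|<\delta$ implies $\|x(t)\|<\varepsilon'$ for all $t>0$; it is asymptotically stable if it is stable and $\|x(t)\|\to0$ as $t\to\infty$ for every $x(0)\in\mathbb R^2$.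 Vector norms are Euclidean; $\cosh^{-1}:[1,\infty)\to[0,\infty)$. *)

(* Defs.v *)
From HB Require Import structures.
From mathcomp Require Import all_boot all_order all_algebra.
From mathcomp Require Import all_classical all_reals all_analysis.
From mathcomp Require Import complex.
From mathcomp Require Import ring lra.

Set Implicit Arguments.
Unset Strict Implicit.
Unset Printing Implicit Defensive.

Import Order.TTheory GRing.Theory Num.Theory.
Import numFieldNormedType.Exports.

Local Open Scope classical_set_scope.
Local Open Scope ring_scope.

Definition mx2 (R : realType) (a b c d : R) : 'M[R]_2 :=
  \matrix_(i < 2, j < 2)
    if i == 0 then (if j == 0 then a else b) else (if j == 0 then c else d).

(* Euclidean norm; the library norm on matrices is the sup norm. *)
Definition enorm (R : realType) (v : 'cV[R]_2) : R :=
  Num.sqrt (\sum_(i < 2) v i 0 ^+ 2).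

Definition spectral_norm (R : realType) (M : 'M[R]_2) : R :=
  sup [set enorm (M *m v) | v in [set v : 'cV[R]_2 | enorm v = 1]].

(* See [thetaE] for the closed form, valid for [0 <= t]. *)
Definition theta (R : realType) (t : R) : R := spectral_norm (mx2 1 t 0 1).

Definition sinh (R : realType) (x : R) : R := (expR x - expR (- x)) / 2.
Definition cosh (R : realType) (x : R) : R := (expR x + expR (- x)) / 2.

(* Inverses of [sinh] on R and of [cosh] on [0, +oo[:
   see [asinhK], [acosh_ge0], [acoshK]. *)
Definition asinh (R : realType) (x : R) : R := ln (x + Num.sqrt (x ^+ 2 + 1)).
Definition acosh (R : realType) (x : R) : R := ln (x + Num.sqrt (x ^+ 2 - 1)).

Definition hurwitz_stable (R : realType) (A : 'M[R]_2) : Prop :=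
  forall z : R[i], eigenvalue (map_mx (real_complex R) A) z -> complex.Re z < 0.

Definition unstable (R : realType) (A : 'M[R]_2) : Prop :=
  exists2 z : R[i],
    eigenvalue (map_mx (real_complex R) A) z & 0 < complex.Re z.

(* The value of a signal at negative times is irrelevant.  [d 0 = 0] is not a
   switching time; the discontinuities are [d 1 < d 2 < ...]. *)
Definition switching_times (R : realType) (sigma : R -> nat) (d : nat -> R) :
    Prop :=
  [/\ d 0%N = 0,
      forall i, d i < d i.+1,
      d @ \oo --> +oo,
      forall i t, d i <= t < d i.+1 -> sigma t = sigma (d i) &
      forall i, sigma (d i.+1) <> sigma (d i)].

(* Walks on the star graph with internal node 1 and leaves 2, ..., N, started
   at the internal node. *)
Definition star_signal (R : realType) (N : nat) (sigma : R -> nat)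
    (d : nat -> R) : Prop :=
  [/\ switching_times sigma d,
      forall i, sigma (d i.*2) = 1%N &
      forall i, (2 <= sigma (d i.*2.+1) <= N)%N].

(* The i-th visit (counted from 0) to the internal node lasts
   [hub_time d i]; the visit to a leaf which follows lasts [leaf_time d i]. *)
Definition hub_time (R : realType) (d : nat -> R) (i : nat) : R :=
  d i.*2.+1 - d i.*2.
Definition leaf_time (R : realType) (d : nat -> R) (i : nat) : R :=
  d i.*2.+2 - d i.*2.+1.

Definition star_signals (R : realType) (N : nat) (tau eta : R) :
    set (R -> nat) :=
  [set sigma | exists d : nat -> R,
    star_signal N sigma d /\
    forall i, tau <= hub_time d i /\ leaf_time d i <= eta].

Definition star_signals' (R : realType) (N : nat) (tau eta : R) :
    set (R -> nat) :=
  [set sigma | exists d : nat -> R,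
    [/\ star_signal N sigma d,
        forall i, tau <= hub_time d i /\ leaf_time d i <= eta &
        ~ ((fun i => (hub_time d i, leaf_time d i)) @ \oo --> (tau, eta))]].

(* Continuous on [0, +oo[, and satisfying the differential equation away from
   the switching times: as [nat] is discrete, [sigma] is continuous at [t] iff
   it is constant near [t]. *)
Definition switched_solution (R : realType) (A : nat -> 'M[R]_2)
    (sigma : R -> nat) (x : R -> 'cV[R]_2) : Prop :=
  {within `[0, +oo[, continuous x} /\
  forall t, 0 < t -> {for t, continuous sigma} ->
    is_derive t (1 : R) x (A (sigma t) *m x t).

Definition switched_stable (R : realType) (A : nat -> 'M[R]_2)
    (sigma : R -> nat) : Prop :=
  forall e : R, 0 < e -> exists2 delta : R, 0 < delta &
    forall x, switched_solution A sigma x -> enorm (x 0) < delta ->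
      forall t, 0 < t -> enorm (x t) < e.

Definition switched_asymptotically_stable (R : realType) (A : nat -> 'M[R]_2)
    (sigma : R -> nat) : Prop :=
  switched_stable A sigma /\
  forall x, switched_solution A sigma x -> enorm (x t) @[t --> +oo] --> 0.

(* Right-hand sides of the equations for the dwell times, for leaves of
   rotation, Jordan block and diagonal type, in terms of
   M = P_j^-1 P_1 = (a b; c d). *)
Definition rotation_rhs (R : realType) (alpha : R) (M : 'M[R]_2)
    (epsilon eta : R) : R :=
  let: (a, b, c, d) := (M 0 0, M 0 1, M 1 0, M 1 1) in
  alpha * eta + acosh ((a ^+ 2 + (b + epsilon * a) ^+ 2
                        + c ^+ 2 + (d + epsilon * c) ^+ 2) / 2).

Definition jordan_rhs (R : realType) (n : R) (M : 'M[R]_2) (epsilon eta : R) :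
    R :=
  let: (c, d) := (M 1 0, M 1 1) in
  n * eta + asinh ((c ^+ 2 + (d + epsilon * c) ^+ 2) / 2 * eta).

Definition diagonal_rhs (R : realType) (p q : R) (M : 'M[R]_2)
    (epsilon eta : R) : R :=
  let: (a, b, c, d) := (M 0 0, M 0 1, M 1 0, M 1 1) in
  let K := (a ^+ 2 + (b + epsilon * a) ^+ 2)
           * (c ^+ 2 + (d + epsilon * c) ^+ 2) in
  (p + q) / 2 * eta + asinh (Num.sqrt K * sinh ((q - p) / 2 * eta)).

Definition leaf_rhs (R : realType) (k l : nat) (alpha n p q : nat -> R)
    (M : nat -> 'M[R]_2) (j : nat) (epsilon eta : R) : R :=
  if (j <= k + 1)%N then rotation_rhs (alpha j) (M j) epsilon eta
  else if (j <= k + l + 1)%N then jordan_rhs (n j) (M j) epsilon eta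
  else diagonal_rhs (p j) (q j) (M j) epsilon eta.

Definition dwell_solution (R : realType) (n1 rhs tau : R) : Prop :=
  0 < tau /\ n1 * tau - ln (theta tau) = rhs.

(* The unique positive solution, when there is one. *)
Definition dwell_time (R : realType) (n1 rhs : R) : R :=
  xget 0 [set tau | dwell_solution n1 rhs tau].

Lemma asinhK (R : realType) (x : R) : sinh (asinh x) = x.
Proof.
rewrite /sinh /asinh; set s := Num.sqrt _.
have s2 : s ^+ 2 = x ^+ 2 + 1 by rewrite sqr_sqrtr // addr_ge0 // sqr_ge0.
have s0 : 0 <= s by exact: sqrtr_ge0.
have y0 : 0 < x + s by nra.
rewrite expRN lnK ?posrE //.
have -> : (x + s)^-1 = s - x.
  apply: (mulfI (lt0r_neq0 y0)); rewrite divff ?lt0r_neq0 //.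
  have -> : (x + s) * (s - x) = s ^+ 2 - x ^+ 2 by ring.
  by rewrite s2; ring.
by field.
Qed.

Lemma acosh_ge0 (R : realType) (x : R) : 1 <= x -> 0 <= acosh x.
Proof.
move=> x1; apply: ln_ge0; rewrite -[1]addr0 lerD // sqrtr_ge0 //.
Qed.

Lemma acoshK (R : realType) (x : R) : 1 <= x -> cosh (acosh x) = x.
Proof.
move=> x1; rewrite /cosh /acosh; set s := Num.sqrt _.
have s2 : s ^+ 2 = x ^+ 2 - 1 by rewrite sqr_sqrtr //; nra.
have s0 : 0 <= s by exact: sqrtr_ge0.
have y0 : 0 < x + s by nra.
rewrite expRN lnK ?posrE //.
have -> : (x + s)^-1 = x - s.
  apply: (mulfI (lt0r_neq0 y0)); rewrite divff ?lt0r_neq0 //.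
  have -> : (x + s) * (x - s) = x ^+ 2 - s ^+ 2 by ring.
  by rewrite s2; ring.
by field.
Qed.

Lemma thetaE (R : realType) (t : R) : 0 <= t ->
  theta t = Num.sqrt (1 + t ^+ 2 / 2 + t * Num.sqrt (1 + t ^+ 2 / 4)).
Proof.
move=> t0; rewrite /theta /spectral_norm.
set s := Num.sqrt (1 + t ^+ 2 / 4); set L := 1 + _ + _.
have s2 : s ^+ 2 = 1 + t ^+ 2 / 4 by rewrite sqr_sqrtr //; nra.
have s0 : 0 < s by rewrite sqrtr_gt0; nra.
have mx2M (v : 'cV[R]_2) : enorm (mx2 1 t 0 1 *m v) =
    Num.sqrt ((v 0 0 + t * v 1 0) ^+ 2 + v 1 0 ^+ 2).
  rewrite /enorm !big_ord_recl big_ord0 !mxE !big_ord_recl !big_ord0 !mxE /=.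
  have -> : lift ord0 ord0 = 1 :> 'I_2 by apply/val_inj.
  by congr Num.sqrt; rewrite addr0 mul1r mul0r mul1r !(addr0, add0r).
have enormE (v : 'cV[R]_2) : enorm v = Num.sqrt (v 0 0 ^+ 2 + v 1 0 ^+ 2).
  rewrite /enorm !big_ord_recl big_ord0.
  have -> : lift ord0 ord0 = 1 :> 'I_2 by apply/val_inj.
  by rewrite addr0.
(* L - 1 = t * m with m the slope of the maximizing direction *)
set m := t / 2 + s.
have Lm : L = 1 + t * m by rewrite /L /m; ring.
have m0 : 0 < m by rewrite /m; nra.
have mm : m ^+ 2 = 1 + t * m.
  have -> : m ^+ 2 = t ^+ 2 / 4 + t * s + s ^+ 2 by rewrite /m; field.
  by rewrite s2 /m; field.
have m20 : 0 < 1 + m ^+ 2 by nra.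
set r := Num.sqrt (1 + m ^+ 2).
have r2 : r ^+ 2 = 1 + m ^+ 2 by rewrite sqr_sqrtr // ltW.
have r0 : 0 < r by rewrite sqrtr_gt0.
set E := [set _ | _ in _].
have ubE : ubound E (Num.sqrt L).
  move=> _ [v /= v1 <-]; rewrite mx2M ler_sqrt; last by rewrite Lm; nra.
  have : v 0 0 ^+ 2 + v 1 0 ^+ 2 = 1.
    have : enorm v ^+ 2 = 1 by rewrite v1 expr1n.
    by rewrite enormE sqr_sqrtr // addr_ge0 // sqr_ge0.
  move: (v 0 0) (v 1 0) => a b ab.
  have -> : L = L * (a ^+ 2 + b ^+ 2) by rewrite ab mulr1.
  rewrite Lm -subr_ge0.
  (* m * difference = t * (m a - b)^2 *)
  rewrite -(pmulr_rge0 _ m0).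
  have -> : m * ((1 + t * m) * (a ^+ 2 + b ^+ 2) - ((a + t * b) ^+ 2 + b ^+ 2))
      = t * (m * a - b) ^+ 2 + t * b ^+ 2 * (m ^+ 2 - (1 + t * m)) by ring.
  by rewrite mm subrr mulr0 addr0 mulr_ge0 // sqr_ge0.
have EL : E (Num.sqrt L).
  exists (\col_(i < 2) if i == 0 then r^-1 else m / r) => /=.
    rewrite enormE !mxE /=.
    have -> : r^-1 ^+ 2 + (m / r) ^+ 2 = (1 + m ^+ 2) / r ^+ 2.
      by field; rewrite lt0r_neq0.
    by rewrite r2 divff ?sqrtr1 // lt0r_neq0.
  rewrite mx2M !mxE /=; congr Num.sqrt.
  have -> : (r^-1 + t * (m / r)) ^+ 2 + (m / r) ^+ 2 =
     ((1 + t * m) ^+ 2 + m ^+ 2) / r ^+ 2 by field; rewrite lt0r_neq0.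
  rewrite r2 -mm Lm -mm; field; rewrite ?lt0r_neq0 //.
apply/le_anti/andP; split.
  by apply: ge_sup => //; exists (Num.sqrt L).
by apply: ub_le_sup => //; exists (Num.sqrt L).
Qed.

(* Main.v *)
Require Import Defs.
From mathcomp Require Import all_boot all_order all_algebra.
From mathcomp Require Import all_classical all_reals all_analysis.
From mathcomp Require Import complex ring lra.

(** In the coordinates [y = Q^-1 x], with [Q = P_1 U] and [U = (1 e; 0 1)], a
    visit of length [t] to the hub multiplies the Euclidean norm of [y] by at
    most [theta t * exp (- n1 t)], whatever [e] is, because [U] commutes with
    the Jordan block [J_1].  A visit of length [s] to the leaf [j] applies
    [X^-1 exp (s J_j) X] with [X = P_j^-1 P_1 U], of determinant [1] or [-1].
    The right-hand side of the equation of the dwell time, taken at [s], is a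
    bound for the logarithm of the norm of this matrix.  Indeed all these norms
    are, up to scalar factors, norms of 2 x 2 matrices of determinant [1] or
    [-1].  Such a matrix has singular values [e^w] and [e^-w], so its norm is
    determined by its Frobenius norm, which is computed explicitly
    ([enorm_mul_le_expR], [rotation_growth], [jordan_growth],
    [diagonal_growth]).

    The function [hub_decay n1 t = n1 t - ln (theta t) = n1 t - asinh (t / 2)]
    is convex, vanishes at [0] and is unbounded, so it takes each positive value
    exactly once and increases from there on.  This gives existence and
    uniqueness of the dwell times ([dwell_solution_unique]).  If [tau] is at
    least every dwell time for [e], a visit to the hub of length at least [tau]
    compensates a following visit to a leaf of length at most [eta]: the norm
    of [y] at the ends of the cycles never increases ([star_cycle_growth]), and within
    a cycle it exceeds its initial value by at most a constant factor.  Hence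
    stability.  If the durations do not converge to [(tau, eta)], infinitely
    many cycles deviate by a fixed amount; strict monotonicity makes them
    contract by a fixed factor ([star_cycle_gap]), and the solution tends to
    [0].

    The minimum over [e] is attained because each dwell time is a continuous
    function of [e] that is either constant or coercive, a class closed under
    pointwise maxima ([constant_or_coercive_max], [constant_or_coercive_min],
    [leaf_rate]). *)

Set Implicit Arguments.
Unset Strict Implicit.
Unset Printing Implicit Defensive.

Import Order.TTheory GRing.Theory Num.Theory.
Import numFieldNormedType.Exports.

Local Open Scope classical_set_scope.
Local Open Scope ring_scope.

(** * Real 2 x 2 matrices and the Euclidean norm *)

Lemma ord2E (i : 'I_2) : i = 0 \/ i = 1.
Proof.
by case: i => [[|[|m]] i2] //; [left|right]; apply/val_inj.
Qed.

Lemma sum2E (V : nmodType) (F : 'I_2 -> V) : \sum_(i < 2) F i = F 0 + F 1.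
Proof.
rewrite !big_ord_recl big_ord0 addr0.
by have -> : lift ord0 ord0 = 1 :> 'I_2 by apply/val_inj.
Qed.

Lemma matrix2P (T : Type) (X Y : 'M[T]_2) :
  X 0 0 = Y 0 0 -> X 0 1 = Y 0 1 -> X 1 0 = Y 1 0 -> X 1 1 = Y 1 1 -> X = Y.
Proof.
move=> e1 e2 e3 e4; apply/matrixP => i j.
by case: (ord2E i) => ->; case: (ord2E j) => ->.
Qed.

Lemma mx2_00 (R : realType) (a b c d : R) : mx2 a b c d 0 0 = a.
Proof. by rewrite mxE. Qed.

Lemma mx2_01 (R : realType) (a b c d : R) : mx2 a b c d 0 1 = b.
Proof. by rewrite mxE. Qed.

Lemma mx2_10 (R : realType) (a b c d : R) : mx2 a b c d 1 0 = c.
Proof. by rewrite mxE. Qed.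

Lemma mx2_11 (R : realType) (a b c d : R) : mx2 a b c d 1 1 = d.
Proof. by rewrite mxE. Qed.

Definition mx2_ij := (mx2_00, mx2_01, mx2_10, mx2_11).

Lemma mulmx2E (R : pzSemiRingType) (m n : nat) (X : 'M[R]_(m, 2))
    (Y : 'M[R]_(2, n)) i j :
  (X *m Y) i j = X i 0 * Y 0 j + X i 1 * Y 1 j.
Proof. by rewrite mxE sum2E. Qed.

Lemma det2E (R : comPzRingType) (X : 'M[R]_2) :
  \det X = X 0 0 * X 1 1 - X 0 1 * X 1 0.
Proof.
rewrite (expand_det_row _ 0) sum2E /cofactor !det_mx11 !mxE /=.
have -> : lift 0 0 = 1 :> 'I_2 by apply/val_inj.
have -> : lift 1 0 = 0 :> 'I_2 by apply/val_inj.
by rewrite addn0 addn1 expr0 expr1 mul1r mulN1r mulrN.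
Qed.

Lemma mulmx_shear (R : realType) (X : 'M[R]_2) (e : R) :
  X *m mx2 1 e 0 1 =
  mx2 (X 0 0) (X 0 1 + e * X 0 0) (X 1 0) (X 1 1 + e * X 1 0).
Proof. by apply: matrix2P; rewrite mulmx2E !mx2_ij; ring. Qed.

Lemma det_mul_shear (R : realType) (X : 'M[R]_2) (e : R) :
  \det (X *m mx2 1 e 0 1) = \det X.
Proof. by rewrite det_mulmx [X in _ * X]det2E !mx2_ij; ring. Qed.

Lemma unitmx_mul_shear (R : realType) (X : 'M[R]_2) (e : R) :
  (X *m mx2 1 e 0 1 \in unitmx) = (X \in unitmx).
Proof. by rewrite !unitmxE det_mul_shear. Qed.

Lemma invmx2E (R : realType) (X : 'M[R]_2) : \det X ^+ 2 = 1 ->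
  invmx X = \det X *: mx2 (X 1 1) (- X 0 1) (- X 1 0) (X 0 0).
Proof.
move=> det1; set Y := _ *: _.
have XY : X *m Y = 1%:M.
  move: det1; rewrite det2E => det1.
  by apply: matrix2P; rewrite mulmx2E !mxE /= ?mulr1n ?mulr0n;
    rewrite det2E -?det1; ring.
have [Xu _] := mulmx1_unit XY.
by rewrite -[LHS]mulmx1 -XY mulKmx.
Qed.

Lemma det_sqr_unitmx (R : realType) (X : 'M[R]_2) :
  \det X ^+ 2 = 1 -> X \in unitmx.
Proof.
rewrite unitmxE unitfE => det1; apply/eqP => det0.
by move: det1; rewrite det0 expr0n => /eqP; rewrite eq_sym oner_eq0.
Qed.

Lemma enormE (R : realType) (v : 'cV[R]_2) :
  enorm v = Num.sqrt (v 0 0 ^+ 2 + v 1 0 ^+ 2).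
Proof. by rewrite /enorm sum2E. Qed.

Lemma enorm_ge0 (R : realType) (v : 'cV[R]_2) : 0 <= enorm v.
Proof. exact: sqrtr_ge0. Qed.

Lemma sqr_enorm (R : realType) (v : 'cV[R]_2) :
  enorm v ^+ 2 = v 0 0 ^+ 2 + v 1 0 ^+ 2.
Proof. by rewrite enormE sqr_sqrtr // addr_ge0 // sqr_ge0. Qed.

Lemma enorm_le (R : realType) (u v : 'cV[R]_2) (r : R) : 0 <= r ->
  u 0 0 ^+ 2 + u 1 0 ^+ 2 <= r ^+ 2 * (v 0 0 ^+ 2 + v 1 0 ^+ 2) ->
  enorm u <= r * enorm v.
Proof.
move=> r0 uv; rewrite -(@ler_pXn2r _ 2) ?nnegrE ?mulr_ge0 ?enorm_ge0 //.
by rewrite exprMn !sqr_enorm.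
Qed.

Lemma enormZ (R : realType) (a : R) (v : 'cV[R]_2) :
  enorm (a *: v) = `|a| * enorm v.
Proof.
rewrite !enormE !mxE -(sqrtr_sqr a) -sqrtrM ?sqr_ge0 //.
by congr Num.sqrt; ring.
Qed.

Definition frob2 (R : realType) (X : 'M[R]_2) : R :=
  X 0 0 ^+ 2 + X 0 1 ^+ 2 + X 1 0 ^+ 2 + X 1 1 ^+ 2.

Lemma frob2_ge0 (R : realType) (X : 'M[R]_2) : 0 <= frob2 X.
Proof. by rewrite /frob2 !addr_ge0 // sqr_ge0. Qed.

Lemma enorm_mul_le_frob2 (R : realType) (X : 'M[R]_2) (v : 'cV[R]_2) :
  enorm (X *m v) <= Num.sqrt (frob2 X) * enorm v.
Proof.
apply: enorm_le; rewrite ?sqrtr_ge0 // sqr_sqrtr ?frob2_ge0 //.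
rewrite !mulmx2E /frob2 -subr_ge0.
set a := X 0 0; set b := X 0 1; set c := X 1 0; set d := X 1 1.
set x := v 0 0; set y := v 1 0.
have -> : (a ^+ 2 + b ^+ 2 + c ^+ 2 + d ^+ 2) * (x ^+ 2 + y ^+ 2) -
    ((a * x + b * y) ^+ 2 + (c * x + d * y) ^+ 2) =
    (a * y - b * x) ^+ 2 + (c * y - d * x) ^+ 2 by ring.
by rewrite addr_ge0 // sqr_ge0.
Qed.

Lemma frob2_ge2 (R : realType) (X : 'M[R]_2) : \det X ^+ 2 = 1 -> 2 <= frob2 X.
Proof.
rewrite det2E /frob2 => det1.
set a := X 0 0 in det1 *; set b := X 0 1 in det1 *.
set c := X 1 0 in det1 *; set d := X 1 1 in det1 *.
have [h|h] := leP 0 (a * d - b * c).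
  have e1 : a * d - b * c = 1 by nra.
  have := sqr_ge0 (a - d); have := sqr_ge0 (b + c); nra.
have e1 : a * d - b * c = - 1 by nra.
have := sqr_ge0 (a + d); have := sqr_ge0 (b - c); nra.
Qed.

(** * Hyperbolic functions *)

Lemma cosh_double (R : realType) (u : R) : cosh (2 * u) = 1 + 2 * sinh u ^+ 2.
Proof.
rewrite /cosh /sinh.
have -> : 2 * u = u + u by ring.
rewrite opprD !expRD; have := expRxMexpNx_1 u.
set x := expR u; set y := expR (- u) => xy.
have -> : 1 + 2 * ((x - y) / 2) ^+ 2 =
  (x * x + y * y) / 2 + (1 - x * y) by field.
by rewrite xy subrr addr0.
Qed.

Lemma cosh_sqr (R : realType) (u : R) : cosh u ^+ 2 = 1 + sinh u ^+ 2.
Proof.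
rewrite /cosh /sinh.
have := expRxMexpNx_1 u; set x := expR u; set y := expR (- u) => xy.
have -> : ((x + y) / 2) ^+ 2 = x * y + ((x - y) / 2) ^+ 2 by field.
by rewrite xy.
Qed.

Lemma cosh_gt0 (R : realType) (u : R) : 0 < cosh u.
Proof. by rewrite /cosh divr_gt0 // addr_gt0 // expR_gt0. Qed.

Lemma sinhD (R : realType) (x y : R) :
  sinh (x + y) = sinh x * cosh y + cosh x * sinh y.
Proof. by rewrite /sinh /cosh opprD !expRD; field. Qed.

Lemma sinh0 (R : realType) : sinh (0 : R) = 0.
Proof. by rewrite /sinh oppr0 subrr mul0r. Qed.

Lemma ltr_sinh (R : realType) : {mono (@sinh R) : x y / x < y}.
Proof.
apply: leW_mono; apply: le_mono => x y xy.
by rewrite /sinh ltr_pM2r // ltrB // ltr_expR // ltrN2.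
Qed.

Lemma ler_sinh (R : realType) : {mono (@sinh R) : x y / x <= y}.
Proof.
apply: le_mono => x y xy; by rewrite ltr_sinh.
Qed.

Lemma sinh_ge0 (R : realType) (x : R) : 0 <= x -> 0 <= sinh x.
Proof. by rewrite -{2}(sinh0 R) ler_sinh. Qed.

Lemma ltr_asinh (R : realType) : {mono (@asinh R) : x y / x < y}.
Proof. by move=> x y; rewrite -ltr_sinh !asinhK. Qed.

Lemma ler_asinh (R : realType) : {mono (@asinh R) : x y / x <= y}.
Proof. by move=> x y; rewrite -ler_sinh !asinhK. Qed.

Lemma sinhK (R : realType) : cancel (@sinh R) (@asinh R).
Proof.
by move=> x; apply: (inc_inj (@ler_sinh R)); rewrite asinhK.
Qed.

Lemma asinh0 (R : realType) : asinh (0 : R) = 0.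
Proof. by rewrite -{1}(sinh0 R) sinhK. Qed.

Lemma asinh_ge0 (R : realType) (x : R) : 0 <= x -> 0 <= asinh x.
Proof. by rewrite -{2}(asinh0 R) ler_asinh. Qed.

(** Conjugated by [sinh], multiplication by [sqrt K] is a map whose slope is at
    least [1]: this is what makes the bound for a diagonal
    leaf increase with time even when the trace [p + q] is negative.  In
    hyperbolic form it says that [cosh u <= sqrt K * cosh x] whenever
    [sinh u = sqrt K * sinh x]. *)
Lemma asinh_sqrt_expand (R : realType) (K x y : R) : 1 <= K -> x <= y ->
  y - x <= asinh (Num.sqrt K * sinh y) - asinh (Num.sqrt K * sinh x).
Proof.
move=> K1 xy; set u := asinh (Num.sqrt K * sinh x).
rewrite lerBrDl -ler_sinh asinhK sinhD.
have -> : sinh y = sinh (x + (y - x)) by congr sinh; ring.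
rewrite [in leRHS]sinhD asinhK.
have K0 : 0 <= K by exact: le_trans K1.
have : 0 <= sinh (y - x) by apply: sinh_ge0; rewrite subr_ge0.
have := cosh_sqr u; rewrite asinhK.
have := cosh_sqr x; have := cosh_gt0 x; have := cosh_gt0 u.
have := sqr_sqrtr K0; have := sqrtr_ge0 K.
move: (sinh (y - x)) (cosh (y - x)) (cosh u) (cosh x) (sinh x) (Num.sqrt K).
move=> S D C c s r r0 r2 C0 c0 c2 C2 S0.
have Crc : C <= r * c.
  rewrite -(@ler_pXn2r _ 2) ?nnegrE ?mulr_ge0 ?(ltW C0) ?(ltW c0) //.
  by rewrite C2 !exprMn c2 r2 mulrDr mulr1 lerD2r.
by rewrite mulrDr !mulrA lerD2l ler_wpM2r.
Qed.

Lemma expR_asinh (R : realType) (x : R) :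
  expR (asinh x) = x + Num.sqrt (x ^+ 2 + 1).
Proof.
rewrite /asinh lnK // posrE -[ltLHS](subrr x) addrC.
have : `|x| < Num.sqrt (x ^+ 2 + 1).
  by rewrite -sqrtr_sqr ltr_sqrt ltr_pwDr // ?sqr_ge0.
by rewrite ltr_norml => /andP[+ _]; lra.
Qed.

(** The norm of a shear is the exponential of the [u] with
    [2 sinh u = t], so the equation of the dwell time reads
    [n1 t - asinh (t / 2) = rhs]. *)
Lemma ln_theta (R : realType) (t : R) : 0 <= t -> ln (theta t) = asinh (t / 2).
Proof.
move=> t0; rewrite thetaE // -[RHS]expRK; congr ln.
rewrite expR_asinh; set s := Num.sqrt (1 + t ^+ 2 / 4).
have -> : (t / 2) ^+ 2 + 1 = 1 + t ^+ 2 / 4 by field.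
have s2 : s ^+ 2 = 1 + t ^+ 2 / 4 by rewrite sqr_sqrtr //; nra.
rewrite -/s -[RHS]ger0_norm -?sqrtr_sqr; last first.
  by rewrite addr_ge0 ?sqrtr_ge0 // divr_ge0.
congr Num.sqrt.
have -> : (t / 2 + s) ^+ 2 = t ^+ 2 / 4 + t * s + s ^+ 2 by field.
by rewrite s2; field.
Qed.

(** * Operator norm bounds *)

(** If [|det X| = 1] the singular values of [X] are [e^w] and [e^-w], and
    [frob2 X = 2 cosh (2 w)].  So all the norms in the proof reduce to
    Frobenius norms.  The inequality says that the symmetric matrix
    [e^(2u) I - X^T X], whose trace and determinant are nonnegative, is positive
    semidefinite. *)
Lemma enorm_mul_le_expR (R : realType) (X : 'M[R]_2) (u : R) (v : 'cV[R]_2) :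
  \det X ^+ 2 = 1 -> 0 <= u -> frob2 X <= 2 * cosh (2 * u) ->
  enorm (X *m v) <= expR u * enorm v.
Proof.
move=> det1 u0 frobX; apply: enorm_le; first exact: expR_ge0.
rewrite !mulmx2E; move: frobX det1; rewrite det2E /frob2.
set a := X 0 0; set b := X 0 1; set c := X 1 0; set d := X 1 1.
set x := v 0 0; set y := v 1 0.
rewrite /cosh mulrCA divff // mulr1.
have e2 : expR (2 * u) = expR u ^+ 2.
  by rewrite expr2 -expRD; congr expR; ring.
rewrite expRN e2; set r := expR u ^+ 2.
have r1 : 1 <= r by have := expR_ge1Dx u; rewrite /r; nra.
have r0 : 0 < r by exact: lt_le_trans r1.
move=> frobX det1.
(* [A, -B; -B, C] is the matrix [r I - X^T X] *)
set A := r - (a ^+ 2 + c ^+ 2); set C := r - (b ^+ 2 + d ^+ 2).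
set B := a * b + c * d.
have rV : r * r^-1 = 1 by rewrite divff // lt0r_neq0.
have rV1 : r^-1 <= 1 by rewrite invf_le1.
have AC0 : 0 <= A + C.
  by rewrite /A /C; lra.
have ACB : 0 <= A * C - B ^+ 2.
  have -> : A * C - B ^+ 2 =
      r * (r - (a ^+ 2 + b ^+ 2 + c ^+ 2 + d ^+ 2)) + (a * d - b * c) ^+ 2.
    by rewrite /A /B /C; ring.
  by rewrite det1; nra.
rewrite -subr_ge0.
have -> : r * (x ^+ 2 + y ^+ 2) - ((a * x + b * y) ^+ 2 + (c * x + d * y) ^+ 2)
   = A * x ^+ 2 - 2 * B * x * y + C * y ^+ 2 by rewrite /A /B /C; ring.
have [A0|A0] := ltP 0 A.
  rewrite -(pmulr_rge0 _ A0).
  have -> : A * (A * x ^+ 2 - 2 * B * x * y + C * y ^+ 2) =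
    (A * x - B * y) ^+ 2 + (A * C - B ^+ 2) * y ^+ 2 by ring.
  by apply: addr_ge0; [exact: sqr_ge0|apply: mulr_ge0 => //; exact: sqr_ge0].
have B0 : B ^+ 2 <= 0 by nra.
have {}B0 : B = 0 by apply/eqP; rewrite -sqrf_eq0; apply/eqP/le_anti;
  rewrite B0 sqr_ge0.
have C0 : 0 <= C by lra.
have A1 : A = 0 \/ C = 0.
  have [->|C1] := eqVneq C 0; [by right|left].
  have : 0 < C by rewrite lt0r C1.
  by move=> ?; move: ACB; rewrite B0; nra.
have A2 : 0 <= A by case: A1; lra.
by rewrite B0; have := sqr_ge0 x; have := sqr_ge0 y; nra.
Qed.

(** * The dwell time as a function of the right-hand side *)

Lemma is_derive_linear (R : realType) (r x : R) :
  is_derive x 1 (fun y => r * y) r.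
Proof.
have h := is_deriveZ r (is_derive_id x (1 : R)).
by apply: is_derive_eq h _; rewrite /GRing.scale /= mulr1.
Qed.

Lemma is_derive_comp_linear (R : realType) (f df : R -> R) (r x : R) :
  (forall y : R, is_derive y 1 f (df y)) ->
  is_derive x 1 (fun y => f (r * y)) (r * df (r * x)).
Proof.
move=> fdf; have h := is_derive1_comp (fdf (r * x)) (is_derive_linear r x).
by apply: is_derive_eq h _; rewrite mulrC.
Qed.

Lemma is_derive_sinh (R : realType) (x : R) : is_derive x 1 (@sinh R) (cosh x).
Proof.
have -> : @sinh R = 2^-1 *: (@expR R - (fun y => expR (-1 * y))).
  by apply/funext => y; rewrite /sinh -(mulN1r y) mulrC.
have h := is_derive_comp_linear (-1) x (@is_derive_expR R).
by apply: is_derive_eq; rewrite /cosh /GRing.scale /= !mulN1r opprK mulrC.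
Qed.

(** [sinh] is convex on the half-line of nonnegative numbers and vanishes at
    [0]. *)
Lemma sinh_scale_le (R : realType) (r u : R) : 0 <= r <= 1 -> 0 <= u ->
  sinh (r * u) <= r * sinh u.
Proof.
move=> /andP[r0 r1] u0.
pose g := fun y => r * sinh (1 * y) - sinh (r * y).
have dg (y : R) : is_derive y 1 g (r * (1 * cosh (1 * y)) - r * cosh (r * y)).
  have d1 := is_derive_comp_linear 1 y (@is_derive_sinh R).
  have d2 := is_derive_comp_linear r y (@is_derive_sinh R).
  by apply: is_derive_eq.
have cg : {within `[0, u], continuous g}.
  apply: continuous_subspaceT => y.
  by apply/differentiable_continuous/derivable1_diffP; case: (dg y).
have [c] := MVT_segment u0 (fun y _ => dg y) cg.
rewrite in_itv /= => /andP[c0 cu].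
rewrite /g !mul1r mulr0 sinh0 mulr0 !subr0 => gE.
rewrite -subr_ge0 gE mulr_ge0 // -mulrBr mulr_ge0 // subr_ge0.
rewrite -(@ler_pXn2r _ 2) ?nnegrE ?(ltW (cosh_gt0 _)) // !cosh_sqr lerD2l.
rewrite ler_pXn2r ?nnegrE ?sinh_ge0 ?mulr_ge0 // ler_sinh.
by rewrite -[leRHS]mul1r ler_wpM2r.
Qed.

(** Minus the logarithm of the norm of the flow of the hub after time [t], in
    coordinates where the hub is a Jordan block. *)
Definition hub_decay (R : realType) (n1 t : R) : R := n1 * t - asinh (t / 2).

Lemma hub_decayE (R : realType) (n1 t : R) : 0 <= t ->
  n1 * t - ln (theta t) = hub_decay n1 t.
Proof. by move=> t0; rewrite ln_theta. Qed.

(** [hub_decay n1] is convex and vanishes at [0], so it lies below its chords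
    from the origin. *)
Lemma hub_decay_chord (R : realType) (n1 s t : R) : 0 <= s -> s <= t -> 0 < t ->
  hub_decay n1 s <= s / t * hub_decay n1 t.
Proof.
move=> s0 st t0.
have r01 : 0 <= s / t <= 1.
  by rewrite divr_ge0 ?(ltW t0) //= ler_pdivrMr // mul1r.
have := sinh_scale_le r01 (asinh_ge0 (divr_ge0 (ltW t0) (ler0n _ 2))).
rewrite asinhK -ler_asinh sinhK /hub_decay => h.
have e1 : s / t * (t / 2) = s / 2 by field; rewrite lt0r_neq0.
have e2 : s / t * (n1 * t) = n1 * s by field; rewrite lt0r_neq0.
by rewrite mulrBr e2 lerD2l lerN2 -[in leRHS]e1.
Qed.

(** By convexity [hub_decay n1] may first decrease below [0], but from the point
    where it becomes positive it increases. *)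
Lemma hub_decay_lt (R : realType) (n1 s t : R) : 0 < s -> s < t ->
  0 < hub_decay n1 s -> hub_decay n1 s < hub_decay n1 t.
Proof.
move=> s0 st f0; have t0 := lt_trans s0 st.
have := hub_decay_chord n1 (ltW s0) (ltW st) t0.
have r1 : s / t < 1 by rewrite ltr_pdivrMr // mul1r.
have r0 : 0 < s / t by rewrite divr_gt0.
move: (hub_decay n1 s) (hub_decay n1 t) f0 => x y x0 xy.
have y0 : 0 < y by rewrite -(pmulr_rgt0 _ r0); exact: lt_le_trans xy.
by apply: le_lt_trans xy _; rewrite -[ltRHS]mul1r ltr_pM2r.
Qed.

Lemma hub_decay_le (R : realType) (n1 s t : R) : 0 < s -> s <= t ->
  0 < hub_decay n1 s -> hub_decay n1 s <= hub_decay n1 t.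
Proof.
move=> s0; rewrite le_eqVlt => /predU1P[->//|st] f0.
exact/ltW/hub_decay_lt.
Qed.

Lemma hub_decay0 (R : realType) (n1 : R) : hub_decay n1 0 = 0.
Proof. by rewrite /hub_decay mulr0 mul0r asinh0 subrr. Qed.

Lemma hub_decay_unbounded (R : realType) (n1 B : R) : 0 < n1 ->
  exists2 t, 0 < t & B <= hub_decay n1 t.
Proof.
move=> n0.
(* chosen so that [u >= 1] and [n1 * u / 2 - 1 >= `|B|] *)
pose u := (2 + 2 * `|B|) / n1 + 1.
have B0 : 0 <= `|B| by [].
have u1 : 1 <= u by rewrite /u lerDr divr_ge0 ?(ltW n0) //; lra.
have nu : 2 + 2 * `|B| <= n1 * u.
  have -> : n1 * u = 2 + 2 * `|B| + n1 by rewrite /u; field; rewrite lt0r_neq0.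
  by rewrite lerDl ltW.
have u0 : 0 < u by lra.
(* in the variable [u = asinh (t / 2)], [t] grows at least quadratically *)
have su : u ^+ 2 / 4 <= sinh u.
  have := @expR_ge1Dxn R u 1 (ltW u0); rewrite (_ : 2`! = 2%N) // => e1.
  have e2 : expR (- u) <= 1 by rewrite -(@expR0 R) ler_expR oppr_le0 ltW.
  by rewrite /sinh; lra.
exists (2 * sinh u); first by nra.
rewrite /hub_decay mulrAC divff // mul1r sinhK.
have := ler_norm B.
nra.
Qed.

Lemma continuous_asinh (R : realType) : continuous (@asinh R).
Proof.
move=> x; pose f (y : R) := y + Num.sqrt (y ^+ 2 + 1).
have : {for x, continuous f}; last first.
  move=> cf; apply: (@continuous_comp _ _ _ f (@ln R) x cf).
  by apply: continuous_ln; rewrite /f -expR_asinh expR_gt0.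
apply: cvgD; first exact: cvg_id.
apply: (@continuous_comp _ _ _ (fun y : R => y ^+ 2 + 1) Num.sqrt); last first.
  exact: sqrt_continuous.
by apply: cvgD; [exact: exprn_continuous|exact: cvg_cst].
Qed.

Lemma continuous_hub_decay (R : realType) (n1 : R) : continuous (hub_decay n1).
Proof.
move=> x; rewrite /hub_decay.
apply: cvgB; first by apply: cvgM; [exact: cvg_cst|exact: cvg_id].
apply: (@continuous_comp _ _ _ (fun y : R => y / 2) (@asinh R)).
  by apply: cvgM; [exact: cvg_id|exact: cvg_cst].
exact: continuous_asinh.
Qed.

Lemma dwell_solutionE (R : realType) (n1 rhs t : R) :
  dwell_solution n1 rhs t <-> 0 < t /\ hub_decay n1 t = rhs.
Proof.
split=> -[t0 <-]; split=> //; first by rewrite hub_decayE // ltW.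
by rewrite hub_decayE // ltW.
Qed.

Lemma dwell_solution_exists (R : realType) (n1 rhs : R) : 0 < n1 -> 0 < rhs ->
  exists t, dwell_solution n1 rhs t.
Proof.
move=> n0 r0; have [T T0 rT] := hub_decay_unbounded rhs n0.
have cf : {within `[0, T], continuous (hub_decay n1)}.
  exact/continuous_subspaceT/continuous_hub_decay.
have [|c] := IVT (v := rhs) (ltW T0) cf.
  by rewrite hub_decay0 ge_min le_max rT (ltW r0) orbT.
rewrite in_itv /= => /andP[c0 cT] fc.
exists c; apply/dwell_solutionE; split => //.
rewrite lt0r c0 andbT; apply: contra_eq_neq fc => ->.
by rewrite hub_decay0 lt_eqF.
Qed.

(** The next two equivalences locate the solution by evaluating [hub_decay];
    both uniqueness and continuous dependence on [rhs] follow from them. *)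
Lemma dwell_solution_lt (R : realType) (n1 rhs s t : R) : 0 < rhs ->
  dwell_solution n1 rhs s -> 0 < t -> (s < t) = (rhs < hub_decay n1 t).
Proof.
move=> r0 /dwell_solutionE[s0 fs] t0; apply/idP/idP => [st|].
  by rewrite -fs hub_decay_lt // fs.
apply: contraTT; rewrite -!leNgt => ts; rewrite leNgt; apply/negP => ft.
have := hub_decay_le t0 ts (lt_trans r0 ft).
by rewrite fs leNgt ft.
Qed.

Lemma dwell_solution_gt (R : realType) (n1 rhs s t : R) : 0 < rhs ->
  dwell_solution n1 rhs s -> 0 < t -> (t < s) = (hub_decay n1 t < rhs).
Proof.
move=> r0 hs t0; have := dwell_solution_lt r0 hs t0.
have [s0 fs] := (dwell_solutionE n1 rhs s).1 hs.
have [ts|st|->] := ltgtP t s; last by rewrite fs ltxx.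
- move=> /esym/negbT; rewrite -leNgt => ft; apply/esym.
  rewrite lt_neqAle ft andbT; apply/eqP => ft'.
  by have := hub_decay_lt (n1 := n1) t0 ts; rewrite ft' fs ltxx => /(_ r0).
- by move=> /esym /ltW; rewrite leNgt => /negbTE ->.
Qed.

Lemma dwell_solution_unique (R : realType) (n1 rhs : R) : 0 < n1 -> 0 < rhs ->
  exists! t, dwell_solution n1 rhs t.
Proof.
move=> n0 r0; have [s hs] := dwell_solution_exists n0 r0.
exists s; split=> // t ht; have [s0 fs] := (dwell_solutionE _ _ _).1 hs.
have [t0 ft] := (dwell_solutionE _ _ _).1 ht.
have := dwell_solution_lt r0 hs t0; have := dwell_solution_gt r0 hs t0.
by rewrite ft ltxx; case: ltgtP.
Qed.

Lemma dwell_timeP (R : realType) (n1 rhs : R) : 0 < n1 -> 0 < rhs ->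
  dwell_solution n1 rhs (dwell_time n1 rhs).
Proof.
move=> n0 r0; have [s hs] := dwell_solution_exists n0 r0.
exact: (@xgetI _ 0 [set t | dwell_solution n1 rhs t] s hs).
Qed.

(** * Minimizing over the shear *)

Definition coercive (R : realType) (h : R -> R) : Prop :=
  forall B, exists r, forall x, r < `|x| -> B < h x.

(** Each dwell time, as a function of the shear, is of this kind; unlike
    coercive functions alone, these functions include the dwell times that do
    not depend on the shear, and they are closed under pointwise maxima. *)
Definition constant_or_coercive (R : realType) (h : R -> R) : Prop :=
  continuous h /\ ((forall x y, h x = h y) \/ coercive h).

Lemma coercive_le (R : realType) (g h : R -> R) :
  coercive g -> (forall x, g x <= h x) -> coercive h.
Proof.
move=> cg gh B; have [r gr] := cg B; exists r => x /gr.
by move/lt_le_trans; apply.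
Qed.

Lemma coercive_comp (R : realType) (phi h : R -> R) : coercive h ->
  (forall B, exists C, forall y, C < y -> B < phi y) ->
  coercive (fun x => phi (h x)).
Proof.
move=> ch cphi B; have [C phiC] := cphi B; have [r hr] := ch C.
by exists r => x /hr /phiC.
Qed.

Lemma coercive_mulr (R : realType) (g h : R -> R) (m : R) : 0 < m ->
  coercive g -> (forall x, m <= h x) -> coercive (fun x => g x * h x).
Proof.
move=> m0 cg mh B; have [r gr] := cg (`|B| / m); exists r => x /gr.
rewrite ltr_pdivrMr // => Bg.
have gx : 0 < g x by rewrite -(pmulr_lgt0 _ m0); exact: le_lt_trans Bg.
apply: le_lt_trans (ler_norm B) _; apply: lt_le_trans Bg _.
by rewrite ler_pM2l.
Qed.

Lemma coercive_affine_sqr (R : realType) (a b : R) : a != 0 ->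
  coercive (fun x => (b + x * a) ^+ 2).
Proof.
move=> a0 B; exists ((`|B| + 1 + `|b|) / `|a|) => x.
rewrite ltr_pdivrMr ?normr_gt0 // -normrM => xa.
have := ler_norm B; have := lerB_dist (x * a) (- b); rewrite opprK normrN.
rewrite addrC [x * a + b]addrC -(real_normK (num_real (b + x * a))).
have := normr_ge0 B; move: xa; nra.
Qed.

Lemma constant_or_coercive_max (R : realType) (g h : R -> R) :
  constant_or_coercive g -> constant_or_coercive h ->
  constant_or_coercive (fun x => Num.max (g x) (h x)).
Proof.
move=> [cg gP] [ch hP]; split.
  by move=> x; apply: (@continuous_max R R^o g h); [exact: cg|exact: ch].
case: gP hP => [gc|gc] [hc|hc]; [left|right|right|right].
- by move=> x y; rewrite (gc x y) (hc x y).
- by apply: coercive_le hc _ => x; rewrite le_max lexx orbT.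
- by apply: coercive_le gc _ => x; rewrite le_max lexx.
- by apply: coercive_le gc _ => x; rewrite le_max lexx.
Qed.

Lemma constant_or_coercive_bigmax (R : realType) (T : eqType) (s : seq T)
    (h : T -> R -> R) :
  (forall j, j \in s -> constant_or_coercive (h j)) ->
  constant_or_coercive (fun x => \big[Num.max/0]_(j <- s) h j x).
Proof.
elim: s => [|j s IHs] hs.
  rewrite (_ : (fun x => _) = (fun=> 0)); last first.
    by apply/funext => x; rewrite big_nil.
  by split; [move=> x; exact: cvg_cst|left].
rewrite (_ : (fun x => _) =
  fun x => Num.max (h j x) (\big[Num.max/0]_(i <- s) h i x)); last first.
  by apply/funext => x; rewrite big_cons.
apply: constant_or_coercive_max; first by apply: hs; rewrite mem_head.
by apply: IHs => i si; apply: hs; rewrite inE si orbT.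
Qed.

Lemma constant_or_coercive_min (R : realType) (h : R -> R) :
  constant_or_coercive h -> exists x0, forall x, h x0 <= h x.
Proof.
move=> [ch [hc|hc]]; first by exists 0 => x; rewrite (hc x 0).
have [r hr] := hc (h 0); pose s := Num.max r 0.
have s0 : - s <= s by rewrite ge0_cp // le_max lexx orbT.
have cs : {within `[- s, s], continuous h} by exact: continuous_subspaceT.
have [c _ hmin] := EVT_min s0 cs.
have c0 : h c <= h 0.
  by apply: hmin; rewrite in_itv /= oppr_le0 andbb le_max lexx orbT.
exists c => x; have [xs|xs] := leP `|x| s.
  by apply: hmin; rewrite in_itv /= -ler_norml.
apply: le_trans c0 _; apply/ltW/hr; apply: le_lt_trans xs.
by rewrite le_max lexx.
Qed.

(** The dwell time inherits continuity because [hub_decay] is increasing near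
    each positive solution, and coercivity because it grows at most
    linearly. *)
Lemma constant_or_coercive_dwell_time (R : realType) (n1 : R) (rhs : R -> R) :
  0 < n1 -> (forall x, 0 < rhs x) -> constant_or_coercive rhs ->
  constant_or_coercive (fun x => dwell_time n1 (rhs x)).
Proof.
move=> n0 r0 [crhs rhsP].
have hP x := dwell_timeP n0 (r0 x).
have hP' x := (dwell_solutionE _ _ _).1 (hP x).
split.
  move=> x0; apply/cvgrPdist_lt => e e0.
  have [t0 ft0] := hP' x0.
  set t := dwell_time n1 (rhs x0) in t0 ft0 *.
  (* the dwell time is compared with positive times only *)
  pose t1 := Num.max (t - e) (t / 2); pose t2 := t + e.
  have t1t : t1 < t by rewrite /t1 gt_max; lra.
  have t10 : 0 < t1 by rewrite /t1 lt_max [X in _ || X]divr_gt0 // orbT.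
  have t20 : 0 < t2 by rewrite /t2; lra.
  have t1e : t - e <= t1 by rewrite /t1 le_max lexx.
  have f1 : hub_decay n1 t1 < rhs x0 by rewrite -(dwell_solution_gt _ (hP x0)).
  have f2 : rhs x0 < hub_decay n1 t2.
    by rewrite -(dwell_solution_lt _ (hP x0)) // -/t /t2; lra.
  have n1' : \forall x \near x0, hub_decay n1 t1 < rhs x.
    exact: (cvgr_gt (rhs x0) (crhs x0)).
  have n2' : \forall x \near x0, rhs x < hub_decay n1 t2.
    exact: (cvgr_lt (rhs x0) (crhs x0)).
  near=> x.
  have : t1 < dwell_time n1 (rhs x).
    by rewrite (dwell_solution_gt _ (hP x)) //; near: x.
  have : dwell_time n1 (rhs x) < t2.
    by rewrite (dwell_solution_lt _ (hP x)) //; near: x.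
  rewrite -/t /t2 => h2 h1; rewrite ltr_norml; apply/andP; split; lra.
case: rhsP => [rc|rc]; [left|right]; first by move=> x y; rewrite (rc x y).
apply: (@coercive_le _ (fun x => rhs x / n1)).
  apply: (coercive_comp (phi := fun y => y / n1)) rc _ => B.
  exists (B * n1) => y.
  by rewrite ltr_pdivlMr.
move=> x; have [t0 ft] := hP' x; rewrite -[X in X / _]ft.
rewrite ler_pdivrMr // /hub_decay [leRHS]mulrC.
by rewrite gerBl asinh_ge0 // divr_ge0 // ltW.
Unshelve. all: by end_near.
Qed.

(** * Growth of the leaf subsystems *)

(** Right-hand form [E' = E J] of the exponential of [s J]: it is the form
    needed to differentiate [E (b - t) z t] along a solution [z]. *)
Definition propagator (R : realType) (J : 'M[R]_2) (E : R -> 'M[R]_2) : Prop :=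
  E 0 = 1%:M /\
  forall i j (s : R), is_derive s 1 (fun t => E t i j) ((E s *m J) i j).

Lemma is_derive_mul (R : realType) (f g : R -> R) (x df dg : R) :
  is_derive x 1 f df -> is_derive x 1 g dg ->
  is_derive x 1 (fun t => f t * g t) (f x * dg + df * g x).
Proof.
move=> hf hg; apply: is_derive_eq (is_deriveM hf hg) _.
by rewrite /GRing.scale /= [g x * _]mulrC.
Qed.

Lemma is_derive_mx2 (R : realType) (a b c d : R -> R) (s da db dc dd : R) i j :
  is_derive s 1 a da -> is_derive s 1 b db ->
  is_derive s 1 c dc -> is_derive s 1 d dd ->
  is_derive s 1 (fun t => mx2 (a t) (b t) (c t) (d t) i j)
    (mx2 da db dc dd i j).
Proof.
move=> ha hb hc hd; case: (ord2E i) => ->; case: (ord2E j) => ->;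
  by under eq_fun do rewrite mx2_ij; rewrite mx2_ij.
Qed.

(** [exp (n s)] times [F] is the exponential of [n I + N] when [F] is that of
    [N]; this serves both rotations and Jordan blocks. *)
Lemma is_derive_expR_scale (R : realType) (n : R) (F : R -> 'M[R]_2)
    (dF : 'M[R]_2) (s : R) i j :
  is_derive s 1 (fun t => F t i j) (dF i j) ->
  is_derive s 1 (fun t => (expR (n * t) *: F t) i j)
    ((expR (n * s) *: (dF + n *: F s)) i j).
Proof.
move=> hF; under eq_fun do rewrite mxE.
have dexp := is_derive_comp_linear n s (@is_derive_expR R).
by apply: is_derive_eq (is_derive_mul dexp hF) _; rewrite !mxE; ring.
Qed.

Lemma propagator_rotation (R : realType) (alpha beta : R) :
  propagator (mx2 alpha beta (- beta) alpha) (fun s => expR (alpha * s) *: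
    mx2 (cos (beta * s)) (sin (beta * s)) (- sin (beta * s)) (cos (beta * s))).
Proof.
split=> [|i j s].
  by rewrite !mulr0 expR0 sin0 cos0 oppr0 scale1r;
    apply: matrix2P; rewrite !mxE.
have dcos := is_derive_comp_linear beta s (@is_derive_cos R).
have dsin := is_derive_comp_linear beta s (@is_derive_sin R).
have dNsin : is_derive s 1 (fun t : R => - sin (beta * t))
    (- (beta * cos (beta * s))) := is_deriveN dsin.
have h := is_derive_expR_scale alpha (is_derive_mx2 i j dcos dsin dNsin dcos).
apply: is_derive_eq h _; congr (_ _ i j).
by apply: matrix2P; rewrite mulmx2E !mxE /=; ring.
Qed.

Lemma propagator_jordan (R : realType) (n : R) :
  propagator (mx2 n 1 0 n) (fun s => expR (n * s) *: mx2 1 s 0 1).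
Proof.
split=> [|i j s].
  by rewrite !mulr0 expR0 scale1r; apply: matrix2P; rewrite !mxE.
have dc (c : R) := is_derive_cst c s (1 : R).
have h := is_derive_expR_scale n
  (is_derive_mx2 i j (dc 1) (is_derive_id s (1 : R)) (dc 0) (dc 1)).
apply: is_derive_eq h _; congr (_ _ i j).
by apply: matrix2P; rewrite mulmx2E !mxE /=; ring.
Qed.

Lemma propagator_diagonal (R : realType) (p q : R) :
  propagator (mx2 p 0 0 q) (fun s => mx2 (expR (p * s)) 0 0 (expR (q * s))).
Proof.
split=> [|i j s].
  by rewrite !mulr0 expR0; apply: matrix2P; rewrite !mxE.
have dp := is_derive_comp_linear p s (@is_derive_expR R).
have dq := is_derive_comp_linear q s (@is_derive_expR R).
have dc := is_derive_cst (0 : R) s (1 : R).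
apply: is_derive_eq (is_derive_mx2 i j dp dc dc dq) _; congr (_ _ i j).
by apply: matrix2P; rewrite mulmx2E !mxE /=; ring.
Qed.

Lemma det_invmx_sqr (R : realType) (X : 'M[R]_2) : \det X ^+ 2 = 1 ->
  \det (invmx X) ^+ 2 = 1.
Proof. by move=> det1; rewrite det_inv exprVn det1 invr1. Qed.

Lemma det_conjmx (R : realType) (X Y : 'M[R]_2) : \det X ^+ 2 = 1 ->
  \det (invmx X *m Y *m X) = \det Y.
Proof.
move=> det1; rewrite !det_mulmx det_inv mulrAC mulVf ?mul1r //.
by rewrite -unitfE -unitmxE det_sqr_unitmx.
Qed.

Lemma enorm_rotation (R : realType) (t : R) (v : 'cV[R]_2) :
  enorm (mx2 (cos t) (sin t) (- sin t) (cos t) *m v) = enorm v.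
Proof.
rewrite !enormE !mulmx2E !mx2_ij; congr Num.sqrt.
have := cos2Dsin2 t; move: (cos t) (sin t) (v 0 0) (v 1 0) => c s x y cs.
have -> : (c * x + s * y) ^+ 2 + (- s * x + c * y) ^+ 2 =
  (c ^+ 2 + s ^+ 2) * (x ^+ 2 + y ^+ 2) by ring.
by rewrite cs mul1r.
Qed.

Lemma frob2_invmx (R : realType) (X : 'M[R]_2) : \det X ^+ 2 = 1 ->
  frob2 (invmx X) = frob2 X.
Proof.
move=> det1; rewrite invmx2E // /frob2 !mxE /=.
by rewrite !exprMn det1; ring.
Qed.

Lemma conjmx_shear_frob2 (R : realType) (X : 'M[R]_2) (s : R) :
  \det X ^+ 2 = 1 ->
  frob2 (invmx X *m mx2 1 s 0 1 *m X) =
  2 + ((X 1 0 ^+ 2 + X 1 1 ^+ 2) * s) ^+ 2.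
Proof.
move=> det1; rewrite invmx2E // /frob2 !mulmx2E !mxE /=; move: det1.
rewrite det2E; move: (X 0 0) (X 0 1) (X 1 0) (X 1 1) => a b c d det1.
transitivity ((a * d - b * c) ^+ 2 *
  (2 * (a * d - b * c) ^+ 2 + ((c ^+ 2 + d ^+ 2) * s) ^+ 2)); first by ring.
by rewrite det1; ring.
Qed.

Lemma conjmx_diagonal_frob2 (R : realType) (X : 'M[R]_2) (u w : R) :
  \det X ^+ 2 = 1 -> u * w = 1 ->
  frob2 (invmx X *m mx2 w 0 0 u *m X) =
  2 + (X 0 0 ^+ 2 + X 0 1 ^+ 2) * (X 1 0 ^+ 2 + X 1 1 ^+ 2) * (u - w) ^+ 2.
Proof.
move=> det1 uw; rewrite invmx2E // /frob2 !mulmx2E !mxE /=; move: det1.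
rewrite det2E; move: (X 0 0) (X 0 1) (X 1 0) (X 1 1) => a b c d det1.
transitivity ((a * d - b * c) ^+ 2 * (2 * (u * w) * (a * d - b * c) ^+ 2 +
  (a ^+ 2 + b ^+ 2) * (c ^+ 2 + d ^+ 2) * (u - w) ^+ 2)); first by ring.
by rewrite det1 uw; ring.
Qed.

(** The Gram determinant of the rows is [\det X ^+ 2 = 1], so the product of
    their squared norms exceeds the square of their inner product by [1]. *)
Lemma row_gram_ge1 (R : realType) (X : 'M[R]_2) : \det X ^+ 2 = 1 ->
  1 <= (X 0 0 ^+ 2 + X 0 1 ^+ 2) * (X 1 0 ^+ 2 + X 1 1 ^+ 2).
Proof.
rewrite det2E => det1; rewrite -det1 -subr_ge0.
rewrite [leRHS](_ : _ = (X 0 0 * X 1 0 + X 0 1 * X 1 1) ^+ 2); last by ring.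
exact: sqr_ge0.
Qed.

Lemma bottom_row_gt0 (R : realType) (X : 'M[R]_2) : \det X ^+ 2 = 1 ->
  0 < X 1 0 ^+ 2 + X 1 1 ^+ 2.
Proof.
move=> /row_gram_ge1; set r := X 0 0 ^+ 2 + _; set s := X 1 0 ^+ 2 + _ => rs.
rewrite lt0r addr_ge0 ?sqr_ge0 // andbT; apply/eqP => s0.
by move: rs; rewrite s0 mulr0 ler10.
Qed.

(** The conjugate of a rotation by [X] has norm at most the condition number
    of [X], that is [e^u] with [2 cosh u = frob2 X]. *)
Lemma rotation_growth (R : realType) (alpha t s : R) (X : 'M[R]_2)
    (v : 'cV[R]_2) :
  \det X ^+ 2 = 1 ->
  enorm (invmx X *m (expR (alpha * s) *:
    mx2 (cos t) (sin t) (- sin t) (cos t)) *m X *m v) <=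
  expR (alpha * s + acosh (frob2 X / 2)) * enorm v.
Proof.
move=> det1; set u := acosh _.
have F1 : 1 <= frob2 X / 2 by rewrite ler_pdivlMr // mul1r frob2_ge2.
have u0 : 0 <= u / 2 by rewrite divr_ge0 // acosh_ge0.
have cu : 2 * cosh (2 * (u / 2)) = frob2 X.
  by rewrite [2 * (u / 2)]mulrC divfK // acoshK // mulrC divfK.
rewrite -scalemxAr -!scalemxAl enormZ ger0_norm ?expR_ge0 // expRD -mulrA.
rewrite ler_pM2l ?expR_gt0 // -!mulmxA.
have -> : expR u = expR (u / 2) * expR (u / 2).
  by rewrite -expRD; congr expR; field.
apply: le_trans (enorm_mul_le_expR _ (det_invmx_sqr det1) u0 _) _.
  by rewrite frob2_invmx // cu.
rewrite enorm_rotation -mulrA ler_pM2l ?expR_gt0 //.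
by apply: enorm_mul_le_expR => //; rewrite cu.
Qed.

(** The conjugate of the shear is the identity plus [s] times a nilpotent matrix
    of norm [X 1 0 ^+ 2 + X 1 1 ^+ 2], hence orthogonally similar to a shear. *)
Lemma jordan_growth (R : realType) (n s : R) (X : 'M[R]_2) (v : 'cV[R]_2) :
  \det X ^+ 2 = 1 -> 0 <= s ->
  enorm (invmx X *m (expR (n * s) *: mx2 1 s 0 1) *m X *m v) <=
  expR (n * s + asinh ((X 1 0 ^+ 2 + X 1 1 ^+ 2) / 2 * s)) * enorm v.
Proof.
move=> det1 s0; set u := asinh _.
rewrite -scalemxAr -!scalemxAl enormZ ger0_norm ?expR_ge0 // expRD -mulrA.
rewrite ler_pM2l ?expR_gt0 //; apply: enorm_mul_le_expR.
- by rewrite det_conjmx // det2E !mx2_ij mulr1 mulr0 subr0 expr1n.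
- apply: asinh_ge0; rewrite mulr_ge0 // divr_ge0 //.
  by rewrite addr_ge0 // sqr_ge0.
- rewrite conjmx_shear_frob2 // cosh_double /u asinhK le_eqVlt.
  by apply/orP; left; apply/eqP; field.
Qed.

(** Up to the factor [e^((p + q) s / 2)] the flow is [diag (e^-h, e^h)], and
    the conjugate has singular values [e^u, e^-u] with
    [sinh u ^+ 2 = K * sinh h ^+ 2]. *)
Lemma diagonal_growth (R : realType) (p q s : R) (X : 'M[R]_2)
    (v : 'cV[R]_2) :
  let K := (X 0 0 ^+ 2 + X 0 1 ^+ 2) * (X 1 0 ^+ 2 + X 1 1 ^+ 2) in
  \det X ^+ 2 = 1 -> p <= q -> 0 <= s ->
  enorm (invmx X *m mx2 (expR (p * s)) 0 0 (expR (q * s)) *m X *m v) <=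
  expR ((p + q) / 2 * s + asinh (Num.sqrt K * sinh ((q - p) / 2 * s))) *
    enorm v.
Proof.
move=> K det1 pq s0; set h := (q - p) / 2 * s; set u := asinh _.
have h0 : 0 <= h by rewrite mulr_ge0 // divr_ge0 // subr_ge0.
have -> : mx2 (expR (p * s)) 0 0 (expR (q * s)) =
    expR ((p + q) / 2 * s) *: mx2 (expR (- h)) 0 0 (expR h).
  apply: matrix2P; rewrite !mxE /= ?mulr0 // -expRD; congr expR;
    by rewrite /h; field.
rewrite -scalemxAr -!scalemxAl enormZ ger0_norm ?expR_ge0 //.
rewrite [in leRHS]expRD -[leRHS]mulrA.
rewrite ler_pM2l ?expR_gt0 //; apply: enorm_mul_le_expR.
- by rewrite det_conjmx // det2E !mx2_ij mulr0 subr0 mulrC expRxMexpNx_1 expr1n.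
- by apply: asinh_ge0; rewrite mulr_ge0 ?sqrtr_ge0 ?sinh_ge0.
- rewrite conjmx_diagonal_frob2 ?expRxMexpNx_1 // cosh_double /u asinhK -/K.
  rewrite exprMn sqr_sqrtr; last by apply: le_trans (row_gram_ge1 det1).
  by rewrite /sinh le_eqVlt; apply/orP; left; apply/eqP; field.
Qed.

(** * The growth rates as functions of time and of the shear *)

(** What the proof uses of a leaf with Jordan form [J] and transition matrix
    [M] to the hub: [g epsilon s] bounds the logarithm of the growth over a
    visit of length [s], in the coordinates sheared by [epsilon]. *)
Definition leaf_rate (R : realType) (J M : 'M[R]_2) (g : R -> R -> R) : Prop :=
  [/\ forall epsilon s t, 0 <= s -> s < t -> g epsilon s < g epsilon t,
      forall epsilon, 0 <= g epsilon 0,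
      forall eta, 0 < eta -> constant_or_coercive (g^~ eta) &
      exists2 E, propagator J E & forall epsilon s v X, 0 <= s ->
        X = M *m mx2 1 epsilon 0 1 ->
        enorm (invmx X *m E s *m X *m v) <= expR (g epsilon s) * enorm v].

Lemma continuous_affine_sqr (R : realType) (a b : R) :
  continuous (fun x : R => (b + x * a) ^+ 2).
Proof.
move=> x; apply: (@continuous_comp _ _ _ (fun x : R => b + x * a)
  (fun y : R => y ^+ 2)); last exact: exprn_continuous.
apply: cvgD; first exact: cvg_cst.
by apply: cvgM; [exact: cvg_id|exact: cvg_cst].
Qed.

Lemma continuous_acosh (R : realType) (x : R) : 1 <= x ->
  {for x, continuous (@acosh R)}.
Proof.
move=> x1; pose f (y : R) := y + Num.sqrt (y ^+ 2 - 1).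
have cf : {for x, continuous f}.
  apply: cvgD; first exact: cvg_id.
  apply: (@continuous_comp _ _ _ (fun y : R => y ^+ 2 - 1) Num.sqrt).
    by apply: cvgB; [exact: exprn_continuous|exact: cvg_cst].
  exact: sqrt_continuous.
apply: (@continuous_comp _ _ _ f (@ln R) x cf).
by apply: continuous_ln; rewrite /f ltr_pwDl ?sqrtr_ge0 //; lra.
Qed.

Lemma ln_le_acosh (R : realType) (x : R) : 0 < x -> ln x <= acosh x.
Proof.
move=> x0; rewrite /acosh ler_ln ?posrE //; last by rewrite ltr_pwDl ?sqrtr_ge0.
by rewrite lerDl sqrtr_ge0.
Qed.

(** A row of a matrix stays away from [0] under shears, and runs to infinity
    unless its first entry vanishes. *)
Lemma row_shear_coercive (R : realType) (a b : R) : a != 0 ->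
  coercive (fun x => a ^+ 2 + (b + x * a) ^+ 2).
Proof.
move=> a0; apply: coercive_le (coercive_affine_sqr b a0) _ => x.
by rewrite lerDr sqr_ge0.
Qed.

Lemma row_shear_ge (R : realType) (a b : R) : a != 0 \/ b != 0 ->
  exists2 m, 0 < m & forall x, m <= a ^+ 2 + (b + x * a) ^+ 2.
Proof.
have [->|a0] := eqVneq a 0.
  case=> // b0; exists (b ^+ 2); first by rewrite exprn_even_gt0.
  by move=> x; rewrite mulr0 addr0 expr0n add0r.
move=> _; exists (a ^+ 2); first by rewrite exprn_even_gt0.
by move=> x; rewrite lerDl sqr_ge0.
Qed.

Lemma continuous_row_shear (R : realType) (a b : R) :
  continuous (fun x : R => a ^+ 2 + (b + x * a) ^+ 2).
Proof.
by move=> x; apply: cvgD; [exact: cvg_cst|exact: continuous_affine_sqr].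
Qed.

Lemma asinh_affine_coercive (R : realType) (k m : R) (h : R -> R) : 0 < m ->
  coercive h -> coercive (fun x => k + asinh (h x * m)).
Proof.
move=> m0 ch.
apply: (coercive_comp (phi := fun y => k + asinh (y * m)) ch) => B.
exists (sinh (B - k) / m) => y.
rewrite ltr_pdivrMr // -(ltr_asinh (sinh _)) sinhK.
by rewrite ltrBlDl.
Qed.

(** Coercive in the shear because the first column of the invertible matrix
    [M] is not zero. *)
Lemma rotation_leaf_rate (R : realType) (alpha beta : R) (M : 'M[R]_2) :
  \det M ^+ 2 = 1 -> 0 < alpha ->
  leaf_rate (mx2 alpha beta (- beta) alpha) M (rotation_rhs alpha M).
Proof.
move=> det1 alpha0.
have detX e : \det (M *m mx2 1 e 0 1) ^+ 2 = 1 by rewrite det_mul_shear.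
have gE e s : rotation_rhs alpha M e s =
    alpha * s + acosh (frob2 (M *m mx2 1 e 0 1) / 2).
  by rewrite mulmx_shear /frob2 !mx2_ij.
have F1 e : 1 <= frob2 (M *m mx2 1 e 0 1) / 2.
  by rewrite ler_pdivlMr // mul1r frob2_ge2.
split=> [e s t s0 st|e|eta eta0|].
- by rewrite !gE ltrD2r ltr_pM2l.
- by rewrite gE mulr0 add0r acosh_ge0.
- pose Q e := (M 0 0 ^+ 2 + (M 0 1 + e * M 0 0) ^+ 2) +
    (M 1 0 ^+ 2 + (M 1 1 + e * M 1 0) ^+ 2).
  have FQ e : frob2 (M *m mx2 1 e 0 1) = Q e.
    by rewrite mulmx_shear /frob2 !mx2_ij /Q !addrA.
  have -> : (rotation_rhs alpha M)^~ eta =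
      fun e => alpha * eta + acosh (Q e / 2).
    by apply/funext => e; rewrite gE FQ.
  split.
    move=> e; apply: cvgD; first exact: cvg_cst.
    apply: (@continuous_comp _ _ _ (fun e => Q e / 2) (@acosh R)); last first.
      by apply: continuous_acosh; rewrite -FQ.
    apply: cvgM; last exact: cvg_cst.
    by apply: cvgD; exact: continuous_row_shear.
  right; apply: (@coercive_comp _ (fun y => alpha * eta + acosh (y / 2)) Q).
    have [a0|a0] := eqVneq (M 0 0) 0.
      have c0 : M 1 0 != 0.
        apply/eqP => c0; move: det1; rewrite det2E a0 c0.
        by rewrite mul0r mulr0 subrr expr0n => /eqP; rewrite eq_sym oner_eq0.
      apply: coercive_le (row_shear_coercive (M 1 1) c0) _ => e.
      by rewrite lerDr addr_ge0 // sqr_ge0.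
    apply: coercive_le (row_shear_coercive (M 0 1) a0) _ => e.
    by rewrite lerDl addr_ge0 // sqr_ge0.
  move=> B; exists (expR (B - alpha * eta) * 2) => y By.
  have y0 : 0 < y / 2.
    rewrite divr_gt0 //; apply: le_lt_trans By.
    by rewrite mulr_ge0 // expR_ge0.
  rewrite -ltrBlDl; apply: lt_le_trans (ln_le_acosh y0).
  by rewrite -ltr_expR lnK ?posrE // ltr_pdivlMr.
- eexists; first exact: propagator_rotation.
  by move=> e s v _ s0 ->; rewrite gE; apply: rotation_growth.
Qed.

(** When [M 1 0 = 0] the line spanned by the eigenvector of the leaf is the one
    of the hub, and the rate does not depend on the shear. *)
Lemma jordan_leaf_rate (R : realType) (n : R) (M : 'M[R]_2) :
  \det M ^+ 2 = 1 -> 0 <= n ->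
  leaf_rate (mx2 n 1 0 n) M (jordan_rhs n M).
Proof.
move=> det1 n0.
have detX e : \det (M *m mx2 1 e 0 1) ^+ 2 = 1 by rewrite det_mul_shear.
pose Q e := M 1 0 ^+ 2 + (M 1 1 + e * M 1 0) ^+ 2.
have gE e s : jordan_rhs n M e s = n * s + asinh (Q e / 2 * s) by [].
have XQ e : (M *m mx2 1 e 0 1) 1 0 ^+ 2 + (M *m mx2 1 e 0 1) 1 1 ^+ 2 = Q e.
  by rewrite mulmx_shear !mx2_ij.
have Q0 e : 0 < Q e by rewrite -XQ bottom_row_gt0.
split=> [e s t s0 st|e|eta eta0|].
- rewrite !gE ler_ltD //; first by rewrite ler_wpM2l // ltW.
  by rewrite ltr_asinh ltr_pM2l // divr_gt0.
- by rewrite gE !mulr0 asinh0 addr0.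
- have -> : (jordan_rhs n M)^~ eta =
      fun e => n * eta + asinh (Q e * (2^-1 * eta)).
    by apply/funext => e; rewrite gE mulrA.
  split.
    move=> e; apply: cvgD; first exact: cvg_cst.
    apply: (@continuous_comp _ _ _ (fun e => Q e * (2^-1 * eta)) (@asinh R)).
      by apply: cvgM; [exact: continuous_row_shear|exact: cvg_cst].
    exact: continuous_asinh.
  have [c0|c0] := eqVneq (M 1 0) 0; [left|right].
    by move=> e e'; rewrite /Q c0 !mulr0.
  apply: asinh_affine_coercive; first by rewrite mulr_gt0.
  exact: row_shear_coercive.
- eexists; first exact: propagator_jordan.
  move=> e s v _ s0 ->; rewrite gE -XQ.
  exact: jordan_growth.
Qed.

(** A scalar leaf ([p = q]) gives a rate that does not depend on the shear.
    Otherwise one of the two rows of [M] has a nonzero first entry, hence a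
    coercive norm, while the norm of the other one stays away from [0]. *)
Lemma diagonal_leaf_rate (R : realType) (p q : R) (M : 'M[R]_2) :
  \det M ^+ 2 = 1 -> p <= q -> 0 < q ->
  leaf_rate (mx2 p 0 0 q) M (diagonal_rhs p q M).
Proof.
move=> det1 pq q0.
have detX e : \det (M *m mx2 1 e 0 1) ^+ 2 = 1 by rewrite det_mul_shear.
pose K1 e := M 0 0 ^+ 2 + (M 0 1 + e * M 0 0) ^+ 2.
pose K2 e := M 1 0 ^+ 2 + (M 1 1 + e * M 1 0) ^+ 2.
have gE e s : diagonal_rhs p q M e s = (p + q) / 2 * s +
  asinh (Num.sqrt (K1 e * K2 e) * sinh ((q - p) / 2 * s)) by [].
have XK e : ((M *m mx2 1 e 0 1) 0 0 ^+ 2 + (M *m mx2 1 e 0 1) 0 1 ^+ 2) *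
    ((M *m mx2 1 e 0 1) 1 0 ^+ 2 + (M *m mx2 1 e 0 1) 1 1 ^+ 2) = K1 e * K2 e.
  by rewrite mulmx_shear !mx2_ij.
have KK e : 1 <= K1 e * K2 e by rewrite -XK row_gram_ge1.
split=> [e s t s0 st|e|eta eta0|].
- rewrite !gE.
  have st' : (q - p) / 2 * s <= (q - p) / 2 * t.
    by rewrite ler_wpM2l ?(ltW st) // divr_ge0 // subr_ge0.
  have := asinh_sqrt_expand (KK e) st'.
  move: (asinh _) (asinh _) => A B AB.
  have : 0 < q * (t - s) by rewrite mulr_gt0 // subr_gt0.
  lra.
- by rewrite gE !mulr0 sinh0 mulr0 asinh0 addr0.
- have cK : continuous (fun e => Num.sqrt (K1 e * K2 e)).
    move=> e; apply: (@continuous_comp _ _ _ (fun e => K1 e * K2 e) Num.sqrt).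
      by apply: cvgM; exact: continuous_row_shear.
    exact: sqrt_continuous.
  split.
    move=> e; apply: cvgD; first exact: cvg_cst.
    apply: (@continuous_comp _ _ _
      (fun e => Num.sqrt (K1 e * K2 e) * sinh ((q - p) / 2 * eta)) (@asinh R)).
      by apply: cvgM; [exact: cK|exact: cvg_cst].
    exact: continuous_asinh.
  have [pq'|pq'] := eqVneq p q; [left|right].
    by move=> e e'; rewrite !gE pq' subrr !mul0r sinh0 !mulr0.
  apply: asinh_affine_coercive.
    rewrite -(sinh0 R) ltr_sinh mulr_gt0 // divr_gt0 // subr_gt0.
    by rewrite lt_neqAle pq'.
  apply: (@coercive_comp _ (@Num.sqrt R) (fun e => K1 e * K2 e)); last first.
    move=> B; exists (`|B| ^+ 2) => y By.
    apply: le_lt_trans (ler_norm B) _; rewrite -(normr_id B) -sqrtr_sqr.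
    rewrite ltr_sqrt //; apply: le_lt_trans By; exact: sqr_ge0.
  have det0 : M 0 0 * M 1 1 - M 0 1 * M 1 0 != 0.
    apply/eqP => d0; move: det1; rewrite det2E d0 expr0n => /eqP.
    by rewrite eq_sym oner_eq0.
  have [a0|a0] := eqVneq (M 0 0) 0.
    have c0 : M 1 0 != 0.
      by apply: contraNneq det0 => ->; rewrite a0 mulr0 mul0r subr0.
    have b0 : M 0 1 != 0.
      by apply: contraNneq det0 => ->; rewrite a0 !mul0r subr0.
    have [m m0 mK] := @row_shear_ge _ (M 0 0) (M 0 1) (or_intror b0).
    rewrite (_ : (fun e => _) = fun e => K2 e * K1 e); last first.
      by apply/funext => e; rewrite mulrC.
    exact: (coercive_mulr m0 (row_shear_coercive _ c0)).
  have cd : M 1 0 != 0 \/ M 1 1 != 0.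
    have [c0|] := eqVneq (M 1 0) 0; last by left.
    by right; apply: contraNneq det0 => ->; rewrite c0 !mulr0 subr0.
  have [m m0 mK] := row_shear_ge cd.
  exact: (coercive_mulr m0 (row_shear_coercive _ a0)).
- eexists; first exact: propagator_diagonal.
  move=> e s v _ s0 ->; rewrite gE -XK.
  exact: diagonal_growth.
Qed.

(** * Sign of the unstable eigenvalue *)

Lemma unstable_similar (R : realType) (A P J : 'M[R]_2) :
  P \in unitmx -> A = P *m J *m invmx P -> unstable A ->
  exists x y (w : 'rV[R[i]]_2), [/\ 0 < x, w != 0 &
    w *m map_mx (real_complex R) J = (x +i* y)%C *: w].
Proof.
move=> Pu AE [[x y] /eigenvalueP[v vA v0] /= x0].
pose f := real_complex R; exists x, y, (v *m map_mx f P); split=> //.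
  apply: contraNneq v0 => vP0.
  have : v *m map_mx f P *m map_mx f (invmx P) = 0 by rewrite vP0 mul0mx.
  by rewrite -mulmxA -map_mxM mulmxV // map_mx1 mulmx1 => ->.
rewrite scalemxAl -vA -!mulmxA -!map_mxM AE.
by rewrite mulmxKV.
Qed.

Lemma row_complex_neq0 (R : realType) (a b c d : R) (w : 'rV[R[i]]_2) :
  w != 0 -> w 0 0 = (a +i* b)%C -> w 0 1 = (c +i* d)%C ->
  0 < (a ^+ 2 + b ^+ 2) + (c ^+ 2 + d ^+ 2).
Proof.
move=> w0 e0 e1; rewrite lt0r !addr_ge0 ?sqr_ge0 // andbT.
apply: contraNneq w0 => /eqP.
rewrite !paddr_eq0 ?addr_ge0 ?sqr_ge0 // !sqrf_eq0.
move=> /andP[/andP[/eqP a0 /eqP b0] /andP[/eqP c0 /eqP d0]].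
apply/eqP/rowP => i; case: (ord2E i) => ->;
  by rewrite mxE ?e0 ?e1 ?a0 ?b0 ?c0 ?d0.
Qed.

(** A complex row eigenvector [w] for [z] satisfies
    [Re z * |w|^2 = alpha * |w|^2], because the part of [J] in [beta] is
    skew-symmetric. *)
Lemma unstable_rotation (R : realType) (A P : 'M[R]_2) (alpha beta : R) :
  P \in unitmx ->
  A = P *m mx2 alpha beta (- beta) alpha *m invmx P -> unstable A -> 0 < alpha.
Proof.
move=> Pu AE /(unstable_similar Pu AE)[x [y [w [x0 w0 wE]]]].
case e0: (w 0 0) => [a b]; case e1: (w 0 1) => [c d].
have n0 := row_complex_neq0 w0 e0 e1.
have : (w *m map_mx (real_complex R) (mx2 alpha beta (- beta) alpha)) 0 0 =
  ((x +i* y)%C *: w) 0 0 by rewrite wE.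
have : (w *m map_mx (real_complex R) (mx2 alpha beta (- beta) alpha)) 0 1 =
  ((x +i* y)%C *: w) 0 1 by rewrite wE.
rewrite !mulmx2E !mxE /= e0 e1 => -[h1 h2] [h3 h4].
have : (x - alpha) * ((a ^+ 2 + b ^+ 2) + (c ^+ 2 + d ^+ 2)) = 0.
  have -> : (x - alpha) * ((a ^+ 2 + b ^+ 2) + (c ^+ 2 + d ^+ 2)) =
    (x * a - y * b) * a + (x * b + y * a) * b + (x * c - y * d) * c +
    (x * d + y * c) * d - alpha * ((a ^+ 2 + b ^+ 2) + (c ^+ 2 + d ^+ 2)).
    by ring.
  by rewrite -h1 -h2 -h3 -h4; ring.
move/eqP; rewrite mulf_eq0 (gt_eqF n0) orbF subr_eq0 => /eqP <-.
exact: x0.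
Qed.

Lemma unstable_diagonal (R : realType) (A P : 'M[R]_2) (p q : R) :
  P \in unitmx ->
  A = P *m mx2 p 0 0 q *m invmx P -> unstable A -> p <= q -> 0 < q.
Proof.
move=> Pu AE /(unstable_similar Pu AE)[x [y [w [x0 w0 wE]]]] pq.
case e0: (w 0 0) => [a b]; case e1: (w 0 1) => [c d].
have n0 := row_complex_neq0 w0 e0 e1.
have : (w *m map_mx (real_complex R) (mx2 p 0 0 q)) 0 0 =
  ((x +i* y)%C *: w) 0 0 by rewrite wE.
have : (w *m map_mx (real_complex R) (mx2 p 0 0 q)) 0 1 =
  ((x +i* y)%C *: w) 0 1 by rewrite wE.
rewrite !mulmx2E !mxE /= e0 e1 => -[h1 h2] [h3 h4].
have hp : (x - p) * (a ^+ 2 + b ^+ 2) = 0.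
  have -> : (x - p) * (a ^+ 2 + b ^+ 2) =
    (x * a - y * b) * a + (x * b + y * a) * b - p * (a ^+ 2 + b ^+ 2) by ring.
  by rewrite -h3 -h4; ring.
have hq : (x - q) * (c ^+ 2 + d ^+ 2) = 0.
  have -> : (x - q) * (c ^+ 2 + d ^+ 2) =
    (x * c - y * d) * c + (x * d + y * c) * d - q * (c ^+ 2 + d ^+ 2) by ring.
  by rewrite -h1 -h2; ring.
have q_or : p = x \/ q = x.
  move: n0; move/eqP: hp; rewrite mulf_eq0 => /orP[|/eqP ->].
    by rewrite subr_eq0 => /eqP ->; left.
  move/eqP: hq; rewrite mulf_eq0 => /orP[|/eqP ->].
    by rewrite subr_eq0 => /eqP ->; right.
  by rewrite addr0 ltxx.
by case: q_or; lra.
Qed.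

(** * Solutions of the switched system *)

Lemma is_derive_coord (R : realType) (x : R -> 'cV[R]_2) (t : R)
    (dx : 'cV[R]_2) i :
  is_derive t 1 x dx -> is_derive t 1 (fun s => x s i 0) (dx i 0).
Proof.
move=> [dr dE]; apply: DeriveDef; first exact: (derivable_mxP _ _ _).1 dr _ _.
by rewrite -dE derive_mx // mxE.
Qed.

Lemma continuous_coord (R : realType) (D : set R) (x : R -> 'cV[R]_2) i :
  {within D, continuous x} -> {within D, continuous (fun s => x s i 0)}.
Proof.
move=> cx t; apply: (@continuous_comp _ _ _ (x : subspace D -> _)
  (fun v : 'cV[R]_2 => v i 0)); first exact: cx.
exact: coord_continuous.
Qed.

(** A matrix solution of the adjoint equation [F' = - F A] has constant
    product with every solution of [x' = A x]. *)
Lemma adjoint_product_constant (R : realType) (A : 'M[R]_2) (F : R -> 'M[R]_2)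
    (x : R -> 'cV[R]_2) (a b : R) :
  a <= b -> {within `[a, b], continuous x} ->
  (forall t, t \in `]a, b[ -> is_derive t 1 x (A *m x t)) ->
  (forall i j (t : R), is_derive t 1 (fun s => F s i j) (- (F t *m A) i j)) ->
  F b *m x b = F a *m x a.
Proof.
move=> ab cx dx dF; apply/colP => i.
pose w t := F t i 0 * x t 0 0 + F t i 1 * x t 1 0.
have wE t : (F t *m x t) i 0 = w t by rewrite mulmx2E.
have cF j : {within `[a, b], continuous (fun s => F s i j)}.
  apply: continuous_subspaceT => t.
  by apply/differentiable_continuous/derivable1_diffP; case: (dF i j t).
have cw : {within `[a, b], continuous w}.
  by move=> t; apply: cvgD; apply: cvgM; (exact: cF || exact: continuous_coord).
have dw t : t \in `]a, b[ -> is_derive t 1 w 0.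
  move=> /dx dxt.
  have d0 := is_derive_mul (dF i 0 t) (is_derive_coord 0 dxt).
  have d1 := is_derive_mul (dF i 1 t) (is_derive_coord 1 dxt).
  by apply: is_derive_eq (is_deriveD d0 d1) _; rewrite !mulmx2E; ring.
rewrite !wE; have [c _] := MVT_segment ab dw cw.
by rewrite mul0r => /eqP; rewrite subr_eq0 => /eqP.
Qed.

(** Applied to [F t = E (b - t) P^-1], which solves the adjoint equation,
    [adjoint_product_constant] integrates the system without uniqueness
    theory. *)
Lemma propagate (R : realType) (A P J : 'M[R]_2) (E : R -> 'M[R]_2)
    (x : R -> 'cV[R]_2) (a b : R) :
  P \in unitmx -> A = P *m J *m invmx P -> propagator J E ->
  a <= b -> {within `[a, b], continuous x} ->
  (forall t, t \in `]a, b[ -> is_derive t 1 x (A *m x t)) ->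
  x b = P *m E (b - a) *m invmx P *m x a.
Proof.
move=> Pu AE [E0 dE] ab cx dx.
pose F t := E (b - t) *m invmx P.
have FA t : F t *m A = E (b - t) *m J *m invmx P.
  by rewrite /F AE !mulmxA mulmxKV.
have dF i j (t : R) : is_derive t 1 (fun s => F s i j) (- (F t *m A) i j).
  rewrite FA mulmx2E; under eq_fun do rewrite mulmx2E.
  have dbt : is_derive t 1 (fun s : R => b - s) (-1).
    apply: is_derive_eq (is_deriveB (is_derive_cst b t (1 : R))
      (is_derive_id t (1 : R))) _.
    by rewrite sub0r.
  have dEb k : is_derive t 1 (fun s => E (b - s) i k)
      ((E (b - t) *m J) i k * -1).
    exact: (@is_derive1_comp _ (fun s => E s i k) (fun s => b - s)).
  have dQ k := is_derive_mul (dEb k) (is_derive_cst (invmx P k j) t (1 : R)).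
  by apply: is_derive_eq (is_deriveD (dQ 0) (dQ 1)) _ => /=; ring.
have := adjoint_product_constant ab cx dx dF.
rewrite /F subrr E0 mul1mx => /(congr1 (mulmx P)).
by rewrite mulKVmx // !mulmxA.
Qed.

(** [Q] is the common change of coordinates in which all the subsystems are
    measured, and [X] passes from it to the Jordan coordinates of one of
    them. *)
Lemma visit_growth (R : realType) (A P J Q X : 'M[R]_2) (E : R -> 'M[R]_2)
    (g : R -> R) (x : R -> 'cV[R]_2) (a b : R) :
  P \in unitmx -> Q \in unitmx -> A = P *m J *m invmx P -> propagator J E ->
  X = invmx P *m Q ->
  (forall s v, 0 <= s ->
     enorm (invmx X *m E s *m X *m v) <= expR (g s) * enorm v) ->
  a <= b -> {within `[a, b], continuous x} ->
  (forall t, t \in `]a, b[ -> is_derive t 1 x (A *m x t)) ->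
  enorm (invmx Q *m x b) <= expR (g (b - a)) * enorm (invmx Q *m x a).
Proof.
move=> Pu Qu AE JE -> gE ab cx dx; rewrite (propagate Pu AE JE ab cx dx).
have := gE (b - a) (invmx Q *m x a); rewrite subr_ge0 => /(_ ab).
have -> : invmx (invmx P *m Q) = invmx Q *m P.
  have Pvu : invmx P \in unitmx by rewrite unitmx_inv.
  have QPX : invmx Q *m P *m (invmx P *m Q) = 1%:M.
    by rewrite mulmxA mulmxK // mulVmx.
  by rewrite -[LHS]mul1mx -QPX mulmxK // unitmx_mul Pvu.
by rewrite !mulmxA mulmxK.
Qed.

Lemma switching_le (R : realType) (d : nat -> R) i j :
  (forall i, d i < d i.+1) -> (i <= j)%N -> d i <= d j.
Proof.
move=> dS; elim: j => [|j IHj]; first by rewrite leqn0 => /eqP ->.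
rewrite leq_eqVlt => /predU1P[->//|]; rewrite ltnS => /IHj h.
exact: le_trans h (ltW (dS j)).
Qed.

Lemma solution_between_switches (R : realType) (A : nat -> 'M[R]_2)
    (sigma : R -> nat) (d : nat -> R) (x : R -> 'cV[R]_2) i b :
  switching_times sigma d -> switched_solution A sigma x ->
  d i <= b <= d i.+1 ->
  {within `[d i, b], continuous x} /\
  forall t, t \in `]d i, b[ -> is_derive t 1 x (A (sigma (d i)) *m x t).
Proof.
move=> [d0 dS _ sE _] [cx dx] /andP[ib bi].
have di0 : 0 <= d i by rewrite -d0 switching_le.
split.
  apply: continuous_subspaceW cx => t /=.
  by rewrite !in_itv /= andbT => /andP[+ _]; exact: le_trans.
move=> t; rewrite in_itv /= => /andP[it tb].
have ti : t < d i.+1 by exact: lt_le_trans bi.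
have st : sigma t = sigma (d i) by apply: sE; rewrite (ltW it).
rewrite -st; apply: dx; first exact: le_lt_trans it.
apply: cvg_near_cst.
have : t \in `]d i, d i.+1[ by rewrite in_itv /= it.
move=> /near_in_itvoo; apply: filterS => s; rewrite in_itv /= => /andP[s1 s2].
by rewrite st; apply: sE; rewrite (ltW s1).
Qed.

(** * From one cycle to the asymptotic behaviour *)

Lemma cycle_of_time (R : realType) (d : nat -> R) (t : R) :
  d 0%N = 0 -> (forall i, d i < d i.+1) -> d @ \oo --> +oo -> 0 <= t ->
  exists k, d k.*2 <= t < d k.*2.+2.
Proof.
move=> d0 dS doo t0.
have ex : exists k, t < d k.*2.+2.
  have /cvgryPgt/(_ t)[n _ nt] := doo; exists n; apply: nt => /=.
  by rewrite -addnn -addn2 -addnA leq_addr.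
case: (ex_minnP ex) => -[|k] tk kmin.
  by exists 0%N; rewrite double0 d0 t0.
exists k.+1; rewrite tk andbT leNgt; apply/negP => /kmin.
by rewrite ltnn.
Qed.

Lemma cycles_le (R : realType) (d : nat -> R) (h : R -> R) (rho : nat -> R)
    m n :
  (forall t, 0 <= h t) -> (forall i, rho i <= 0) ->
  (forall i, h (d i.*2.+2) <= expR (rho i) * h (d i.*2)) ->
  (m <= n)%N -> h (d n.*2) <= h (d m.*2).
Proof.
move=> h0 rho0 hrho; elim: n => [|n IHn]; first by rewrite leqn0 => /eqP ->.
rewrite leq_eqVlt => /predU1P[->//|]; rewrite ltnS => /IHn.
apply: le_trans; rewrite doubleS; apply: le_trans (hrho n) _.
by rewrite ler_piMl // -(@expR0 R) ler_expR.
Qed.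

Lemma cycles_bounded (R : realType) (d : nat -> R) (h : R -> R)
    (rho : nat -> R) (C : R) m t :
  d 0%N = 0 -> (forall i, d i < d i.+1) -> d @ \oo --> +oo ->
  (forall t, 0 <= h t) -> 0 <= C -> (forall i, rho i <= 0) ->
  (forall i, h (d i.*2.+2) <= expR (rho i) * h (d i.*2)) ->
  (forall i t, d i.*2 <= t <= d i.*2.+2 -> h t <= C * h (d i.*2)) ->
  d m.*2 <= t -> h t <= C * h (d m.*2).
Proof.
move=> d0 dS doo h0 C0 rho0 hrho hC mt.
have t0 : 0 <= t by apply: le_trans mt; rewrite -d0 switching_le.
have [k /andP[kt tk]] := cycle_of_time d0 dS doo t0.
apply: le_trans (hC k t _) _; first by rewrite kt ltW.
apply: ler_wpM2l => //; apply: (cycles_le h0 rho0 hrho).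
rewrite leqNgt; apply/negP => km; move: tk; apply/negP; rewrite -leNgt.
by apply: le_trans mt; apply: switching_le; rewrite // -doubleS leq_double.
Qed.

(** Since [h (d n.*2)] never increases, infinitely many factors bounded by
    [expR (- kappa)] make it arbitrarily small. *)
Lemma cycles_small (R : realType) (d : nat -> R) (h : R -> R)
    (rho : nat -> R) (kappa e : R) :
  (forall t, 0 <= h t) -> (forall i, rho i <= 0) ->
  (forall i, h (d i.*2.+2) <= expR (rho i) * h (d i.*2)) ->
  0 < kappa -> (forall n, exists2 i, (n <= i)%N & rho i <= - kappa) ->
  0 < e -> exists m, h (d m.*2) < e.
Proof.
move=> h0 rho0 hrho kappa0 often e0; pose r := expR (- kappa).
have geo k : exists m, h (d m.*2) <= r ^+ k * h (d 0%N).
  elim: k => [|k [m hm]]; first by exists 0%N; rewrite expr0 mul1r double0.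
  have [i mi rhoi] := often m; exists i.+1; rewrite doubleS.
  apply: le_trans (hrho i) _; rewrite exprS -mulrA.
  apply: ler_pM; rewrite ?expR_ge0 ?ler_expR //.
  exact: le_trans (cycles_le h0 rho0 hrho mi) hm.
have r1 : `|r| < 1.
  by rewrite ger0_norm ?expR_ge0 // -(@expR0 R) ltr_expR oppr_lt0.
have : (fun k => r ^+ k * h (d 0%N)) @ \oo --> 0 * h (d 0%N).
  by apply: cvgM; [exact: cvg_expr|exact: cvg_cst].
rewrite mul0r => /cvgrPdist_lt/(_ e e0)[k _ /(_ k (leqnn k))].
rewrite /= sub0r normrN => rk; have [m hm] := geo k; exists m.
by apply: le_lt_trans hm _; apply: le_lt_trans rk; exact: ler_norm.
Qed.

(** As [u] can only deviate upwards and [v] downwards, failure of convergence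
    means infinitely many deviations of a fixed size, each in the direction that
    improves the contraction. *)
Lemma not_cvg_often (R : realType) (u v : nat -> R) (a b : R) :
  (forall i, a <= u i) -> (forall i, v i <= b) ->
  ~ ((fun i => (u i, v i)) @ \oo --> (a, b)) ->
  exists2 delta, 0 < delta &
    forall n, exists2 i, (n <= i)%N & a + delta <= u i \/ v i <= b - delta.
Proof.
move=> ua vb; apply: contra_notP => H.
have Hd delta : 0 < delta -> exists n, forall i, (n <= i)%N ->
    u i < a + delta /\ b - delta < v i.
  move=> d0; apply: contrapT => Hn; apply: H; exists delta => // n.
  apply: contrapT => Hi; apply: Hn; exists n => i ni; split.
    by rewrite ltNge; apply/negP => h; apply: Hi; exists i => //; left.
  by rewrite ltNge; apply/negP => h; apply: Hi; exists i => //; right.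
have ca : u @ \oo --> a.
  apply/cvgrPdist_lt => e e0; have [n hn] := Hd e e0.
  exists n => // i /= /hn[h _].
  by rewrite ltr_norml; have := ua i; lra.
have cb : v @ \oo --> b.
  apply/cvgrPdist_lt => e e0; have [n hn] := Hd e e0.
  exists n => // i /= /hn[_ h].
  by rewrite ltr_norml; have := vb i; lra.
exact: cvg_pair ca cb.
Qed.

Lemma uniform_gap (R : realType) (N : nat) (e : nat -> R) :
  (forall j, (j <= N)%N -> 0 < e j) ->
  exists2 kappa, 0 < kappa & forall j, (j <= N)%N -> kappa <= e j.
Proof.
elim: N => [|N IHN] e0.
  by exists (e 0%N) => [|j]; [exact: e0|rewrite leqn0 => /eqP ->].
have [|k k0 ke] := IHN; first by move=> j jN; apply: e0; exact: leqW.
exists (Num.min k (e N.+1)); first by rewrite lt_min k0 e0.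
move=> j; rewrite leq_eqVlt => /predU1P[->|]; first by rewrite ge_min lexx orbT.
by rewrite ltnS => /ke kj; rewrite ge_min kj.
Qed.

(** * Cycles of a walk on the star *)

(** The shear [mx2 1 e 0 1] commutes with the Jordan block of the hub.  This
    is the freedom in the choice of coordinates over which the dwell time is
    minimized: it changes the bounds for the leaves, but not the one for the
    hub. *)
Lemma hub_visit_growth (R : realType) (A P Q : 'M[R]_2) (n1 e : R)
    (x : R -> 'cV[R]_2) (a b : R) :
  P \in unitmx -> A = P *m mx2 (- n1) 1 0 (- n1) *m invmx P ->
  Q = P *m mx2 1 e 0 1 ->
  a <= b -> {within `[a, b], continuous x} ->
  (forall t, t \in `]a, b[ -> is_derive t 1 x (A *m x t)) ->
  enorm (invmx Q *m x b) <=
    expR (- hub_decay n1 (b - a)) * enorm (invmx Q *m x a).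
Proof.
move=> Pu AE QE ab cx dx.
have det1 : \det (mx2 1 e 0 1 : 'M[R]_2) ^+ 2 = 1.
  by rewrite -[mx2 _ _ _ _]mul1mx det_mul_shear det1 expr1n.
have Qu : Q \in unitmx by rewrite QE unitmx_mul_shear.
apply: (visit_growth (g := fun s => - hub_decay n1 s) Pu Qu AE
  (propagator_jordan (- n1)) (X := mx2 1 e 0 1)) => [|s v s0|//|//].
  by rewrite QE mulKmx.
(* the bottom row of the shear is [(0, 1)] for every [e] *)
have := jordan_growth (- n1) v det1 s0; rewrite !mx2_ij.
rewrite expr0n add0r expr1n mul1r [2^-1 * s]mulrC.
by rewrite /hub_decay opprB addrC mulNr.
Qed.

(** A visit to the hub may start with a transient growth; this bounds it. *)
Lemma hub_decay_ge (R : realType) (n1 tau t : R) : 0 < n1 -> 0 < tau ->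
  0 < hub_decay n1 tau -> 0 <= t -> - asinh (tau / 2) <= hub_decay n1 t.
Proof.
move=> n0 tau0 f0 t0; have [tt|tt] := leP tau t.
  apply: le_trans (hub_decay_le tau0 tt f0).
  by apply: le_trans (ltW f0); rewrite oppr_le0 asinh_ge0 // divr_ge0 // ltW.
have : asinh (t / 2) <= asinh (tau / 2) by rewrite ler_asinh ler_pM2r // ltW.
by rewrite /hub_decay; have := mulr_ge0 (ltW n0) t0; lra.
Qed.

(** Bound for the logarithm of the growth over the [i]-th cycle, made of a visit
    to the hub and of the visit to a leaf that follows. *)
Definition star_cycle_rate (R : realType) (n1 e : R) (g : nat -> R -> R -> R)
    (sigma : R -> nat) (d : nat -> R) (i : nat) : R :=
  g (sigma (d i.*2.+1)) e (leaf_time d i) - hub_decay n1 (hub_time d i).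

Lemma leaf_time_gt0 (R : realType) (d : nat -> R) i :
  (forall i, d i < d i.+1) -> 0 < leaf_time d i.
Proof. by move=> dS; rewrite subr_gt0. Qed.

Lemma leaf_rate_le (R : realType) (J M : 'M[R]_2) (g : R -> R -> R)
    (e s t : R) :
  leaf_rate J M g -> 0 <= s -> s <= t -> g e s <= g e t.
Proof.
move=> [gS _ _ _] s0; rewrite le_eqVlt => /predU1P[->//|st].
exact/ltW/gS.
Qed.

(** Longer visits to the hub only decrease the bound and shorter visits to a
    leaf do not increase it, so each cycle is no worse than the extreme one, of
    durations [tau] and [eta], for which the bound is at most [0]. *)
Lemma star_cycle_growth (R : realType) (N : nat) (A P J : nat -> 'M[R]_2)
    (n1 e tau eta : R) (g : nat -> R -> R -> R) (sigma : R -> nat)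
    (d : nat -> R) (x : R -> 'cV[R]_2) (i : nat) :
  (forall j, (1 <= j <= N)%N -> P j \in unitmx) ->
  (forall j, (1 <= j <= N)%N -> A j = P j *m J j *m invmx (P j)) ->
  J 1%N = mx2 (- n1) 1 0 (- n1) ->
  (forall j, (2 <= j <= N)%N ->
     leaf_rate (J j) (invmx (P j) *m P 1%N) (g j)) ->
  0 < n1 -> 0 < tau -> 0 < hub_decay n1 tau ->
  (forall j, (2 <= j <= N)%N -> g j e eta <= hub_decay n1 tau) ->
  star_signal N sigma d ->
  (forall i, tau <= hub_time d i /\ leaf_time d i <= eta) ->
  switched_solution A sigma x ->
  let h t := enorm (invmx (P 1%N *m mx2 1 e 0 1) *m x t) in
  let rho := star_cycle_rate n1 e g sigma d in
  [/\ rho i <= 0, h (d i.*2.+2) <= expR (rho i) * h (d i.*2) &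
    forall t, d i.*2 <= t <= d i.*2.+2 ->
      h t <= expR (asinh (tau / 2)) * h (d i.*2)].
Proof.
move=> Pu AE J1 gP n0 tau0 f0 geta [sw hub leaf] hd sol h rho.
have [d0 dS doo _ _] := sw.
have [taui etai] := hd i; have leafi := leaf i.
set j := sigma (d i.*2.+1) in leafi.
have j2 : (2 <= j)%N by case/andP: leafi.
have jN : (1 <= j <= N)%N by case/andP: leafi => /ltnW -> ->.
have N1 : (1 <= 1 <= N)%N.
  by case/andP: jN => _; rewrite /= => /(leq_trans (ltnW j2)).
have ft : hub_decay n1 tau <= hub_decay n1 (hub_time d i).
  exact: hub_decay_le.
have hubG t : d i.*2 <= t <= d i.*2.+1 ->
    h t <= expR (- hub_decay n1 (t - d i.*2)) * h (d i.*2).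
  move=> tI; have [cx dx] := solution_between_switches sw sol tI.
  have A1 := AE 1%N N1; rewrite J1 in A1; rewrite hub in dx.
  by case/andP: tI => it _; apply: (hub_visit_growth (Pu 1%N N1) A1 erefl).
have Qu : P 1%N *m mx2 1 e 0 1 \in unitmx by rewrite unitmx_mul_shear Pu.
have leafG t : d i.*2.+1 <= t <= d i.*2.+2 ->
    h t <= expR (g j e (t - d i.*2.+1)) * h (d i.*2.+1).
  move=> tI; have [cx dx] := solution_between_switches sw sol tI.
  have [_ _ _ [E JE gE]] := gP j leafi.
  case/andP: tI => it _.
  apply: (visit_growth (Pu j jN) Qu (AE j jN) JE (esym (mulmxA _ _ _))) => //.
  by move=> s v s0; apply: (gE e).
have h0 t : 0 <= h t by exact: enorm_ge0.
have leaf_le t : d i.*2.+1 <= t <= d i.*2.+2 ->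
    g j e (t - d i.*2.+1) <= hub_decay n1 tau.
  move=> /andP[it ti]; apply: le_trans (geta j leafi).
  apply: (leaf_rate_le _ (gP j leafi)); first by rewrite subr_ge0.
  by apply: le_trans etai; rewrite lerD2r.
have dI : d i.*2.+1 <= d i.*2.+2 <= d i.*2.+2 by rewrite lexx ltW.
have hubI : d i.*2 <= d i.*2.+1 <= d i.*2.+1 by rewrite lexx ltW.
have rho0 : rho i <= 0.
  by rewrite subr_le0; apply: le_trans ft; exact: leaf_le.
have two_visits t : d i.*2.+1 <= t <= d i.*2.+2 -> h t <=
    expR (g j e (t - d i.*2.+1) - hub_decay n1 (hub_time d i)) * h (d i.*2).
  move=> tI; apply: le_trans (leafG t tI) _.
  by rewrite expRD -mulrA ler_pM2l ?expR_gt0 //; exact: hubG.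
split=> //; first exact: two_visits.
have C1 : 0 <= asinh (tau / 2) by rewrite asinh_ge0 // divr_ge0 // ltW.
move=> t /andP[it ti]; have [ti1|ti1] := leP t (d i.*2.+1).
  apply: le_trans (hubG t _) _; first by rewrite it.
  apply: ler_wpM2r => //; rewrite ler_expR lerNl.
  by apply: hub_decay_ge => //; rewrite subr_ge0.
have tI : d i.*2.+1 <= t <= d i.*2.+2 by rewrite ti ltW.
apply: le_trans (two_visits t tI) _; apply: ler_wpM2r => //.
by rewrite ler_expR; have := leaf_le t tI; lra.
Qed.

(** Each deviation from [(tau, eta)] of a fixed size gains a fixed amount: by
    strict monotonicity of [hub_decay] after [tau], and of the rates of the
    leaves, which are finitely many. *)
Lemma star_cycle_gap (R : realType) (N : nat) (P J : nat -> 'M[R]_2)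
    (n1 e tau eta : R) (g : nat -> R -> R -> R) (sigma : R -> nat)
    (d : nat -> R) :
  (forall j, (2 <= j <= N)%N ->
     leaf_rate (J j) (invmx (P j) *m P 1%N) (g j)) ->
  0 < tau -> 0 < hub_decay n1 tau -> 0 < eta ->
  (forall j, (2 <= j <= N)%N -> g j e eta <= hub_decay n1 tau) ->
  star_signal N sigma d ->
  (forall i, tau <= hub_time d i /\ leaf_time d i <= eta) ->
  ~ ((fun i => (hub_time d i, leaf_time d i)) @ \oo --> (tau, eta)) ->
  exists2 kappa, 0 < kappa & forall m,
    exists2 i, (m <= i)%N & star_cycle_rate n1 e g sigma d i <= - kappa.
Proof.
move=> gP tau0 f0 eta0 geta [sw hub leaf] hd ncvg.
have [_ dS _ _ _] := sw.
have [delta delta0 often] :=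
  not_cvg_often (fun i => (hd i).1) (fun i => (hd i).2) ncvg.
(* the rates are monotone on nonnegative times only *)
pose s := Num.max (eta - delta) 0.
have s0 : 0 <= s by rewrite le_max lexx orbT.
have seta : s < eta by rewrite gt_max eta0 andbT; lra.
(* any positive value would do at the indices that are not leaves *)
pose gap j := if (2 <= j)%N then g j e eta - g j e s else 1.
have [|k1 k10 k1gap] := @uniform_gap R N gap.
  move=> j jN; rewrite /gap; case: ifP => // j2.
  by have [gS _ _ _] := gP j (introT andP (conj j2 jN)); rewrite subr_gt0 gS.
pose k2 := hub_decay n1 (tau + delta) - hub_decay n1 tau.
have k20 : 0 < k2 by rewrite subr_gt0 hub_decay_lt // ltrDl.
exists (Num.min k1 k2); first by rewrite lt_min k10.
move=> m; have [i mi hi] := often m; exists i => //.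
have [taui etai] := hd i; have leafi := leaf i.
have ft : hub_decay n1 tau <= hub_decay n1 (hub_time d i).
  exact: hub_decay_le.
have li0 := ltW (leaf_time_gt0 i dS).
have fe := geta _ leafi.
rewrite /star_cycle_rate lerNr opprB ge_min; apply/orP.
case: hi => [hi|hi]; [right|left].
  have := leaf_rate_le e (gP _ leafi) li0 etai.
  have : hub_decay n1 (tau + delta) <= hub_decay n1 (hub_time d i).
    apply: hub_decay_le => //; first by rewrite addr_gt0.
    by apply: (lt_trans f0); apply: hub_decay_lt; rewrite // ltrDl.
  by rewrite /k2; lra.
have ls : leaf_time d i <= s by rewrite le_max hi.
have := leaf_rate_le e (gP _ leafi) li0 ls.
have := k1gap (sigma (d i.*2.+1)); rewrite /gap.
by case/andP: leafi => -> -> /(_ isT); lra.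
Qed.

(** * Stability *)

(** Stability for any shear [e], provided that [tau] dominates the dwell times
    for this [e]. *)
Lemma star_stable (R : realType) (N : nat) (A P J : nat -> 'M[R]_2)
    (n1 e tau eta : R) (g : nat -> R -> R -> R) (sigma : R -> nat)
    (d : nat -> R) :
  (forall j, (1 <= j <= N)%N -> P j \in unitmx) ->
  (forall j, (1 <= j <= N)%N -> A j = P j *m J j *m invmx (P j)) ->
  J 1%N = mx2 (- n1) 1 0 (- n1) ->
  (forall j, (2 <= j <= N)%N ->
     leaf_rate (J j) (invmx (P j) *m P 1%N) (g j)) ->
  0 < n1 -> 0 < tau -> 0 < hub_decay n1 tau -> 0 < eta ->
  (forall j, (2 <= j <= N)%N -> g j e eta <= hub_decay n1 tau) ->
  star_signal N sigma d ->
  (forall i, tau <= hub_time d i /\ leaf_time d i <= eta) ->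
  switched_stable A sigma /\
  (~ ((fun i => (hub_time d i, leaf_time d i)) @ \oo --> (tau, eta)) ->
   switched_asymptotically_stable A sigma).
Proof.
move=> Pu AE J1 gP n0 tau0 f0 eta0 geta star hd.
have [[d0 dS doo _ _] _ leaf] := star.
have N1 : (1 <= 1 <= N)%N.
  by case/andP: (leaf 0%N) => j2 /(leq_trans (ltnW j2)).
pose Q := P 1%N *m mx2 1 e 0 1.
have Qu : Q \in unitmx by rewrite unitmx_mul_shear Pu.
pose h (x : R -> 'cV[R]_2) t := enorm (invmx Q *m x t).
pose C := expR (asinh (tau / 2)).
pose a := Num.sqrt (frob2 Q); pose b := Num.sqrt (frob2 (invmx Q)).
have C0 : 0 <= C by exact: expR_ge0.
have a0 : 0 <= a by exact: sqrtr_ge0.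
have b0 : 0 <= b by exact: sqrtr_ge0.
have h0 x t : 0 <= h x t by exact: enorm_ge0.
have xh x t : enorm (x t) <= a * h x t.
  by rewrite -[x t in leLHS](mulKVmx Qu); exact: enorm_mul_le_frob2.
have hx x t : h x t <= b * enorm (x t) by exact: enorm_mul_le_frob2.
pose rho := star_cycle_rate n1 e g sigma d.
have cyc x i (sol : switched_solution A sigma x) :=
  @star_cycle_growth _ N A P J n1 e tau eta g sigma d x i
    Pu AE J1 gP n0 tau0 f0 geta star hd sol.
have bounded x m t : switched_solution A sigma x -> d m.*2 <= t ->
    h x t <= C * h x (d m.*2).
  move=> sol; apply: (cycles_bounded d0 dS doo (h0 x) C0 (rho := rho)) => i.
  - by have [] := cyc x i sol.
  - by have [] := cyc x i sol.
  - by move=> s; have [_ _] := cyc x i sol; apply.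
have stab : switched_stable A sigma.
  move=> eps eps0; pose D := a * C * b + 1.
  have D0 : 0 < D by rewrite ltr_wpDl // !mulr_ge0.
  exists (eps / D); first by rewrite divr_gt0.
  move=> x sol x0 t t0.
  have := bounded x 0%N t sol; rewrite double0 d0 => /(_ (ltW t0)) hC.
  have xt : enorm (x t) <= a * C * b * enorm (x 0).
    apply: le_trans (xh x t) _; rewrite -!mulrA ler_wpM2l //.
    by apply: le_trans hC _; rewrite ler_wpM2l.
  apply: le_lt_trans xt _; move: x0; rewrite ltr_pdivlMr // => x0.
  by apply: le_lt_trans x0; rewrite mulrC ler_wpM2l ?enorm_ge0 // lerDl.
split=> // ncvg; split=> // x sol.
have [kappa kappa0 often] := star_cycle_gap gP tau0 f0 eta0 geta star hd ncvg.
apply/cvgrPdist_lt => eps eps0.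
have D0 : 0 < a * C + 1 by rewrite ltr_wpDl // mulr_ge0.
have [| | |m hm] := @cycles_small _ d (h x) rho kappa (eps / (a * C + 1))
  (h0 x) _ _ kappa0 often _.
- by move=> i; have [] := cyc x i sol.
- by move=> i; have [] := cyc x i sol.
- by rewrite divr_gt0.
exists (d m.*2); split; first exact: num_real.
move=> t /ltW mt; rewrite sub0r normrN ger0_norm ?enorm_ge0 //.
move: hm; rewrite ltr_pdivlMr //; apply: le_lt_trans.
apply: le_trans (xh x t) _.
apply: le_trans (_ : a * (C * h x (d m.*2)) <= _).
  by rewrite ler_wpM2l // bounded.
by rewrite mulrA mulrC ler_wpM2l // lerDl.
Qed.

Theorem theorem13p4 (R : realType) (N k l : nat)
    (A P J : nat -> 'M[R]_2) (alpha beta n p q : nat -> R) (eta : R)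
    (hP : forall j, (1 <= j <= N)%N -> P j \in unitmx)
    (hA : forall j, (1 <= j <= N)%N -> A j = P j *m J j *m invmx (P j))
    (hA1 : hurwitz_stable (A 1%N))
    (hAj : forall j, (2 <= j <= N)%N -> unstable (A j))
    (hdet : forall j, (2 <= j <= N)%N ->
      \det (invmx (P j) *m P 1%N) = 1 \/ \det (invmx (P j) *m P 1%N) = -1)
    (hn1 : 0 < n 1%N)
    (hJ1 : J 1%N = mx2 (- n 1%N) 1 0 (- n 1%N))
    (hN : (k + l + 1 <= N)%N)
    (hrotation : forall j, (2 <= j <= k + 1)%N ->
      [/\ J j = mx2 (alpha j) (beta j) (- beta j) (alpha j),
          0 <= alpha j & beta j != 0])
    (hjordan : forall j, (k + 1 < j <= k + l + 1)%N ->
      J j = mx2 (n j) 1 0 (n j) /\ 0 <= n j)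
    (hdiagonal : forall j, (k + l + 1 < j <= N)%N ->
      [/\ J j = mx2 (p j) 0 0 (q j), p j <= q j & (p j, q j) <> (0, 0)])
    (heta : 0 < eta) :
  let M j := invmx (P j) *m P 1%N in
  let rhs j epsilon := leaf_rhs k l alpha n p q M j epsilon eta in
  let tau12 j epsilon := dwell_time (n 1%N) (rhs j epsilon) in
  let tau_max epsilon := \big[Num.max/0]_(2 <= j < N.+1) tau12 j epsilon in
  let tau := inf (range tau_max) in
  [/\ forall j epsilon, (2 <= j <= N)%N ->
        exists! t, dwell_solution (n 1%N) (rhs j epsilon) t,
      exists epsilon0, forall epsilon, tau_max epsilon0 <= tau_max epsilon,
      forall sigma, star_signals N tau eta sigma -> switched_stable A sigma &
      forall sigma, star_signals' N tau eta sigma ->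
        switched_asymptotically_stable A sigma].
Proof.
move=> M rhs tau12 tau_max tau.
pose g j := leaf_rhs k l alpha n p q M j.
have gP j : (2 <= j <= N)%N -> leaf_rate (J j) (M j) (g j).
  move=> jN; have j1N : (1 <= j <= N)%N by case/andP: jN => /ltnW -> ->.
  have det1 : \det (M j) ^+ 2 = 1.
    by case: (hdet j jN) => ->; rewrite ?sqrrN expr1n.
  rewrite /g /leaf_rhs; case: (leqP j (k + 1)) => [jk|kj].
    have [|JE alpha0 _] := hrotation j; first by case/andP: jN => ->.
    rewrite JE; apply: rotation_leaf_rate => //.
    apply: (unstable_rotation (hP j j1N) (beta := beta j) _ (hAj j jN)).
    by rewrite -JE hA.
  case: (leqP j (k + l + 1)) => [jl|lj].
    have [|JE n0] := hjordan j; first by rewrite kj.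
    by rewrite JE; exact: jordan_leaf_rate.
  have [|JE pq _] := hdiagonal j; first by case/andP: jN => _ ->; rewrite lj.
  rewrite JE; apply: diagonal_leaf_rate => //.
  apply: (unstable_diagonal (hP j j1N) (p := p j) _ (hAj j jN)) => //.
  by rewrite -JE hA.
have rhs0 j epsilon : (2 <= j <= N)%N -> 0 < rhs j epsilon.
  move=> /gP[gS g0 _ _]; apply: le_lt_trans (g0 epsilon) _.
  exact: gS.
have [epsilon0 tau_min] : exists epsilon0, forall epsilon,
    tau_max epsilon0 <= tau_max epsilon.
  apply: constant_or_coercive_min; apply: constant_or_coercive_bigmax => j.
  rewrite mem_index_iota ltnS => jN.
  apply: constant_or_coercive_dwell_time => //; first by move=> x; exact: rhs0.
  by have [_ _ + _] := gP j jN; exact.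
have tauE : tau = tau_max epsilon0.
  apply/le_anti/andP; split.
    by apply: ge_inf; [exists (tau_max epsilon0) => _ [x _ <-]|exists epsilon0].
  apply: lb_le_inf; first by exists (tau_max epsilon0); exists epsilon0.
  by move=> _ [x _ <-].
have tau_ge j : (2 <= j <= N)%N -> tau12 j epsilon0 <= tau.
  move=> jN; rewrite tauE.
  apply: (@le_bigmax_seq _ R _ _ 0 j xpredT (fun i => tau12 i epsilon0)) => //.
  by rewrite mem_index_iota ltnS.
have tau_rhs j : (2 <= j <= N)%N ->
    [/\ 0 < tau, 0 < hub_decay (n 1%N) tau &
      g j epsilon0 eta <= hub_decay (n 1%N) tau].
  move=> jN; have r0 := rhs0 j epsilon0 jN.
  have [t0 ft] := (dwell_solutionE _ _ _).1 (dwell_timeP hn1 r0).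
  have ge_t := tau_ge j jN.
  have : rhs j epsilon0 <= hub_decay (n 1%N) tau.
    by rewrite -[leLHS]ft; apply: hub_decay_le; rewrite // ft.
  split=> //; [exact: lt_le_trans ge_t|exact: lt_le_trans r0 _].
have star sigma d : star_signal N sigma d ->
    (forall i, tau <= hub_time d i /\ leaf_time d i <= eta) ->
    switched_stable A sigma /\
    (~ ((fun i => (hub_time d i, leaf_time d i)) @ \oo --> (tau, eta)) ->
     switched_asymptotically_stable A sigma).
  move=> st hd; have [_ _ leaf] := st; have [tau0 f0 _] := tau_rhs _ (leaf 0%N).
  apply: (star_stable (e := epsilon0) hP hA hJ1 gP hn1 tau0 f0 heta _ st hd).
  by move=> j /tau_rhs[].
split.
- by move=> j epsilon jN; apply: dwell_solution_unique => //; exact: rhs0.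
- by exists epsilon0.
- by move=> sigma [d [st hd]]; have [] := star sigma d st hd.
- by move=> sigma [d [st hd ncvg]]; have [_] := star sigma d st hd; apply.
Qed.
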